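(* Let $X$ be a weighted $2$-complex which satisfies the perimeter reduction hypothesis, and let $\widehat X\to X$ be a (connected) covering space. Then: (A) If $Y$ is a compact connected subcomplex of $\widehat X$ and the inclusion $Y\to\widehat X$ is not $\pi_1$-injective, then $Y$ is contained in a compact connected subcomplex $Y'\subset\widehat X$ with $\mathbf{P}(Y')<\mathbf{P}(Y)$. (B) For any compact subcomplex $C\subset\widehat X$ there exists a compact connected subcomplex $Y\subset \widehat X$ containing $C$ such that $\mathbf{P}(Y)$ is minimal among all compact connected subcomplexes of $\widehat X$ containing $C$. Consequently $\pi_1X$ is coherent.
   Context: A group is coherent if all its finitely generated subgroups are finitely presented. Complexes and maps. All complexes are combinatorial $2$-complexes and all maps are combinatorial: a map of CW complexes is combinatorial if its restriction to each open cell is a homeomorphism onto an open cell of the target; a $2$-complex is combinatorial if the attaching maps of its cells are combinatorial after a suitable subdivision. A $2$-cell of $X$ is regarded as a map $R\to X$, where $R$ is a polygon (a disc with $n\ge 1$ $0$-cells, $n$ $1$-cells and one $2$-cell) and $\partial R\to X$ is the attaching map. Attaching maps of $2$-cells are assumed to be immersions (locally injective). Spaces whose fundamental group is taken are connected. A map is a $1$-immersion if it is locally injective on the $1$-skeleton of its domain; it is $\pi_1$-injective if it induces an injection on $\pi_1$. Sides and perimeter. A side of $X$ is a pair $(R,r)$ with $R$ a $2$-cell of $X$ and $r$ a $1$-cell of $\partial R$; it is present at the $1$-cell $x$ of $X$ that is the image of $r$. Let $\phi:Y\to X$ be a map and $y$ a $1$-cell of $Y$. A side $(R,r)$ present at $\phi(y)$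 is present at $y$ if there is a map $\rho:R\to Y$ with $\rho(r)=y$ and $\phi\circ\rho$ equal to $R\to X$; otherwise it is missing at $y$. A weighted $2$-complex is a $2$-complex $X$ with a nonnegative integer weight $\mathbf{Wt}((R,r))$ assigned to each side such that for each $1$-cell $x$ the perimeter $\mathbf{P}(x)=\sum_{(R,r)\text{ present at }x}\mathbf{Wt}((R,r))$ is finite, and for each $2$-cell $R$ the weight $\mathbf{Wt}(R)=\sum_{r\in \mathrm{Edges}(\partial R)}\mathbf{Wt}((R,r))$ is positive. The perimeter of $\phi:Y\to X$ is $\mathbf{P}(\phi)=\mathbf{P}(Y)=\sum_{y\in\mathrm{Edges}(Y)}\ \sum_{(R,r)\text{ missing at }y}\mathbf{Wt}((R,r))$. For a subcomplex $Y$ of a cover $\widehat X\to X$, $\mathbf{P}(Y)$ is the perimeter of the composition $Y\to\widehat X\to X$. Perimeter reduction hypothesis. A weighted $2$-complex $X$ satisfies it if for every compact connected $Y$ and every based $1$-immersion $\phi:Y\to X$ that is not $\pi_1$-injective, there are a based map $\phi^+:Y^+\to X$ and a map $Y\to Y^+$ with $\phi$ equal to the composition $Y\to Y^+\to X$, such that $Y^+$ is compact and connected, $\mathbf{P}(Y^+)<\mathbf{P}(Y)$, and $\phi^+_*(\pi_1Y^+)=\phi_*(\pi_1Y)$. *)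

(* Defs.v *)
From HB Require Import structures.
From mathcomp Require Import all_boot generic_quotient all_classical.

Set Implicit Arguments.
Unset Strict Implicit.
Unset Printing Implicit Defensive.

Local Open Scope classical_set_scope.

(* Combinatorial 2-complexes are represented by their cell structure.  Every
   1-cell carries an arbitrary reference orientation; a dart [(e, b)] is the
   1-cell [e] traversed forwards if [b = false] and backwards if [b = true].
   The 2-cell [c] is attached along the closed edge path
   [bd c 0, bd c 1, ..., bd c (len c - 1)], so that the 1-cells of the boundary
   polygon of [c] are the elements of ['I_(len c)], cyclically ordered by
   [ordS]. *)

Definition drev (E : Type) (d : E * bool) : E * bool := (d.1, ~~ d.2).

Definition dflip (E : Type) (b : bool) (d : E * bool) : E * bool :=
  (d.1, b (+) d.2).

Definition dstart (V E : Type) (s t : E -> V) (d : E * bool) : V :=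
  if d.2 then t d.1 else s d.1.

(* [bd_immersed]: consecutive boundary edges never backtrack, that is, the
   attaching map is locally injective at the 0-cells of the polygon. *)
Record complex := Complex {
  vert : choiceType;
  edge : choiceType;
  cell : choiceType;
  esrc : edge -> vert;
  etgt : edge -> vert;
  len : cell -> nat;
  len_gt0 : forall c, 0 < len c;
  bd : forall c, 'I_(len c) -> edge * bool;
  bd_closed : forall c (i : 'I_(len c)),
    dstart esrc etgt (drev (bd i)) = dstart esrc etgt (bd (ordS i));
  bd_immersed : forall c (i : 'I_(len c)), bd (ordS i) <> drev (bd i)
}.

Arguments esrc {_}. Arguments etgt {_}. Arguments len {_}. Arguments bd {_} c.

Definition dart (X : complex) : choiceType := (edge X * bool)%type.

Definition dsrc (X : complex) (d : dart X) : vert X := dstart esrc etgt d.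
Definition dtgt (X : complex) (d : dart X) : vert X := dsrc (drev d : dart X).

(* The pairs (R, r) with R a 2-cell and r a 1-cell of its boundary polygon. *)
Definition side (X : complex) : choiceType := {c : cell X & 'I_(len c)}.

(* The 1-cell at which a side is present. *)
Definition side_edge (X : complex) (s : side X) : edge X :=
  (bd (tag s) (tagged s)).1.

(* Combinatorial maps.  A 1-cell goes to a 1-cell, possibly reversing the
   reference orientations.  A 2-cell [c] goes homeomorphically onto the 2-cell
   [fcell c]; up to isotopy this amounts to the isomorphism [fside c] of boundary
   polygons, which preserves or (if [cflip c]) reverses the cyclic order.  The
   map [fside] is genuine data: it is not determined by the 1-skeleton when the
   attaching map of [fcell c] is a proper power. *)
Record cmap (Y X : complex) := CMap {
  fvert :> vert Y -> vert X;
  fedge : edge Y -> dart X;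
  fcell : cell Y -> cell X;
  fside : forall c, 'I_(len c) -> 'I_(len (fcell c));
  cflip : cell Y -> bool;
  fedge_src : forall e, dsrc (fedge e) = fvert (esrc e);
  fedge_tgt : forall e, dtgt (fedge e) = fvert (etgt e);
  fcell_len : forall c, len (fcell c) = len c;
  fside_cyc : forall c (i : 'I_(len c)),
    if cflip c then ordS (fside (ordS i)) = fside i
    else fside (ordS i) = ordS (fside i);
  fside_bd : forall c (i : 'I_(len c)),
    dflip (bd c i).2 (fedge (bd c i).1)
      = dflip (cflip c) (bd (fcell c) (fside i))
}.

Definition fdart (Y X : complex) (f : cmap Y X) (d : dart Y) : dart X :=
  dflip d.2 (fedge f d.1).

Definition side_map (Y X : complex) (f : cmap Y X) (s : side Y) : side X :=
  Tagged (fun c => 'I_(len c)) (fside f (tagged s)).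

(* Equality of combinatorial maps (up to isotopy through combinatorial maps). *)
Definition cmap_eq (Y X : complex) (f g : cmap Y X) : Prop :=
  [/\ forall v, f v = g v,
      forall e, fedge f e = fedge g e &
      forall s, side_map f s = side_map g s].

Lemma drevK (E : Type) : involutive (@drev E).
Proof. by case=> e b; rewrite /drev negbK. Qed.

Lemma drev_neq (E : Type) (d : E * bool) : drev d <> d.
Proof. by case: d => e b [] /esym; case: b. Qed.

Lemma dflip_drev (E : Type) b (d : E * bool) : dflip b (drev d) = drev (dflip b d).
Proof. by rewrite /dflip /drev /= addbN. Qed.

Lemma dflip_dflip (E : Type) a b (d : E * bool) :
  dflip a (dflip b d) = dflip (a (+) b) d.
Proof. by rewrite /dflip /= addbA. Qed.

Lemma dflip_false (E : Type) (d : E * bool) : dflip false d = d.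
Proof. by case: d. Qed.

Lemma dflip_true (E : Type) (d : E * bool) : dflip true d = drev d.
Proof. by []. Qed.

Lemma fdart_drev (Y X : complex) (f : cmap Y X) (d : dart Y) :
  fdart f (drev d) = drev (fdart f d).
Proof. by rewrite /fdart /drev /dflip /= addNb. Qed.

Lemma fdart_dflip (Y X : complex) (f : cmap Y X) b (d : dart Y) :
  fdart f (dflip b d) = dflip b (fdart f d).
Proof. by rewrite /fdart /dflip /= addbA. Qed.

Lemma dsrc_fdart (Y X : complex) (f : cmap Y X) (d : dart Y) :
  dsrc (fdart f d) = f (dsrc d).
Proof.
case: d => e [].
  by rewrite /fdart /= dflip_true [RHS](esym (fedge_tgt f e)).
by rewrite /fdart /= dflip_false fedge_src.
Qed.

Lemma dtgt_fdart (Y X : complex) (f : cmap Y X) (d : dart Y) :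
  dtgt (fdart f d) = f (dtgt d).
Proof. by rewrite /dtgt -fdart_drev dsrc_fdart. Qed.

Lemma fdart_bd (Y X : complex) (f : cmap Y X) (c : cell Y) (i : 'I_(len c)) :
  fdart f (bd c i) = dflip (cflip f c) (bd (fcell f c) (fside f i)).
Proof. exact: fside_bd. Qed.

Section Composition.
Variables (Z Y X : complex) (g : cmap Y X) (f : cmap Z Y).

Let ce (e : edge Z) : dart X := fdart g (fedge f e).
Let cc (c : cell Z) : cell X := fcell g (fcell f c).
Let cs (c : cell Z) (i : 'I_(len c)) : 'I_(len (cc c)) := fside g (fside f i).
Let cf (c : cell Z) : bool := cflip g (fcell f c) (+) cflip f c.

Fact comp_src e : dsrc (ce e) = g (f (esrc e)).
Proof. by rewrite /ce dsrc_fdart fedge_src. Qed.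

Fact comp_tgt e : dtgt (ce e) = g (f (etgt e)).
Proof. by rewrite /ce dtgt_fdart fedge_tgt. Qed.

Fact comp_len c : len (cc c) = len c.
Proof. by rewrite /cc !fcell_len. Qed.

Fact comp_cyc c (i : 'I_(len c)) :
  if cf c then ordS (cs (ordS i)) = cs i else cs (ordS i) = ordS (cs i).
Proof.
rewrite /cf /cs; have := fside_cyc f i; set j := fside f (ordS i).
have := fside_cyc g (fside f i); have := fside_cyc g j.
case: (cflip g _) (cflip f c) => -[] /= h1 h2 h3.
- by rewrite -h3 -h1.
- by rewrite h3 -h2.
- by rewrite -h3 h1.
- by rewrite h3 h2.
Qed.

Fact comp_bd c (i : 'I_(len c)) :
  dflip (bd c i).2 (ce (bd c i).1) = dflip (cf c) (bd (cc c) (cs i)).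
Proof.
by rewrite /ce /cf /cs /cc addbC -dflip_dflip -fdart_bd -!fdart_dflip fside_bd.
Qed.

Definition cmap_comp : cmap Z X :=
  @CMap Z X (fun v => g (f v)) ce cc cs cf comp_src comp_tgt comp_len comp_cyc
    comp_bd.

End Composition.

Fact polygon_immersed n (i : 'I_n) : (ordS i, false) <> drev (i, false).
Proof. by []. Qed.

(* The disc with [n] 0-cells, [n] 1-cells and one 2-cell. *)
Definition polygon (n : nat) (n_gt0 : 0 < n) : complex :=
  @Complex 'I_n 'I_n unit id (@ordS n) (fun=> n) (fun=> n_gt0)
    (fun _ i => (i, false)) (fun _ _ => erefl)
    (fun _ i => @polygon_immersed n i).

(* The 2-cell [c] regarded as a map from its polygon to the complex. *)
Definition char_map (X : complex) (c : cell X) : cmap (polygon (len_gt0 c)) X :=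
  @CMap (polygon (len_gt0 c)) X (fun i => dsrc (bd c i : dart X)) (bd c)
    (fun=> c) (fun _ i => i) (fun=> false) (fun=> erefl) (bd_closed (c := c))
    (fun=> erefl) (fun _ _ => erefl) (fun _ _ => erefl).

Definition is_lift (Y X : complex) (f : cmap Y X) (c : cell X)
    (rho : cmap (polygon (len_gt0 c)) Y) : Prop :=
  cmap_eq (cmap_comp f rho) (char_map c).

Definition present (Y X : complex) (f : cmap Y X) (y : edge Y) : set (side X) :=
  [set s | exists rho : cmap (polygon (len_gt0 (tag s))) Y,
      is_lift f rho /\ (fedge rho (tagged s)).1 = y].

Definition missing (Y X : complex) (f : cmap Y X) (y : edge Y) : set (side X) :=
  [set s | side_edge s = (fedge f y).1 /\ ~ present f y s].

(* A sum of nonnegative integers is finite if and only if all but finitely many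
   of its terms vanish. *)
Record weight (X : complex) := Weight {
  wt :> side X -> nat;
  perim_edge_fin : forall x : edge X,
    finite_set [set s | side_edge s = x /\ wt s <> 0];
  wt_cell_gt0 : forall c : cell X,
    0 < \sum_(i < len c) wt (Tagged (fun c => 'I_(len c)) i)
}.

(* The sums range over the (finite) supports of the summands. *)
Definition perimeter (X : complex) (w : weight X) (Y : complex)
    (f : cmap Y X) : nat :=
  \big[addn/0]_(y \in [set: edge Y]) \big[addn/0]_(s \in missing f y) w s.

Record subcomplex (X : complex) := Subcomplex {
  svert : set (vert X);
  sedge : set (edge X);
  scell : set (cell X);
  sedge_src : forall e, sedge e -> svert (esrc e);
  sedge_tgt : forall e, sedge e -> svert (etgt e);
  scell_bd : forall c (i : 'I_(len c)), scell c -> sedge (bd c i).1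
}.

Definition subcomplex_le (X : complex) (A B : subcomplex X) : Prop :=
  [/\ svert A `<=` svert B, sedge A `<=` sedge B & scell A `<=` scell B].

Section ComplexOfSubcomplex.
Variables (X : complex) (A : subcomplex X).

Let sv : choiceType := svert A.
Let se : choiceType := sedge A.
Let sc : choiceType := scell A.

Definition sub_src (e : se) : sv :=
  exist _ (esrc (val e)) (mem_set (sedge_src (set_mem (valP e)))).
Definition sub_tgt (e : se) : sv :=
  exist _ (etgt (val e)) (mem_set (sedge_tgt (set_mem (valP e)))).
Definition sub_bd (c : sc) (i : 'I_(len (val c))) : se * bool :=
  (exist _ (bd (val c) i).1 (mem_set (scell_bd i (set_mem (valP c)))),
   (bd (val c) i).2).

Lemma val_dstart (d : se * bool) :
  val (dstart sub_src sub_tgt d) = dstart esrc etgt (val d.1, d.2).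
Proof. by case: d => e []. Qed.

Fact sub_bd_closed (c : sc) (i : 'I_(len (val c))) :
  dstart sub_src sub_tgt (drev (sub_bd i)) =
  dstart sub_src sub_tgt (sub_bd (ordS i)).
Proof.
apply: val_inj; rewrite !val_dstart /=.
by have := bd_closed i; rewrite /drev; case: (bd _ (ordS i)).
Qed.

Fact sub_bd_immersed (c : sc) (i : 'I_(len (val c))) :
  sub_bd (ordS i) <> drev (sub_bd i).
Proof.
move=> []h1 h2; apply: (@bd_immersed X (val c) i).
by rewrite /drev -h1 -h2; case: (bd _ (ordS i)).
Qed.

Definition complex_of : complex :=
  @Complex sv se sc sub_src sub_tgt (fun c => len (val c))
    (fun c => len_gt0 (val c)) sub_bd sub_bd_closed sub_bd_immersed.

Definition sub_incl : cmap complex_of X :=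
  @CMap complex_of X val (fun e => (val e, false)) val (fun _ i => i)
    (fun=> false) (fun=> erefl) (fun=> erefl) (fun=> erefl)
    (fun _ _ => erefl) (fun c i => congr1 (pair _) (addbF _)).

End ComplexOfSubcomplex.

(* Compactness of a CW complex amounts to finiteness. *)
Definition compact (X : complex) : Prop :=
  [/\ finite_set [set: vert X], finite_set [set: edge X] &
      finite_set [set: cell X]].

(* [epath u v p]: the sequence of darts [p] is an edge path from [u] to [v]. *)
Fixpoint epath (X : complex) (u v : vert X) (p : seq (dart X)) : bool :=
  if p is d :: q then (dsrc d == u) && epath (dtgt d) v q else u == v.

Definition connected (X : complex) : Prop :=
  inhabited (vert X) /\ forall u v : vert X, exists p, epath u v p.

(* The attaching path of [c], read once around from its [i]-th 0-cell. *)
Definition bpath (X : complex) (c : cell X) (i : 'I_(len c)) : seq (dart X) :=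
  [seq bd c (iter k (@ordS _) i) | k <- iota 0 (len c)].

(* Homotopy relative to the endpoints of edge paths from [u] to [v], generated
   by removing backtracks and attaching paths of 2-cells. *)
Inductive homotopic (X : complex) (u v : vert X) :
    seq (dart X) -> seq (dart X) -> Prop :=
| homotopic_refl p : epath u v p -> homotopic u v p p
| homotopic_sym p q : homotopic u v p q -> homotopic u v q p
| homotopic_trans p q r :
    homotopic u v p q -> homotopic u v q r -> homotopic u v p r
| homotopic_backtrack p q (d : dart X) :
    epath u v (p ++ [:: d; drev d] ++ q) ->
    homotopic u v (p ++ [:: d; drev d] ++ q) (p ++ q)
| homotopic_cell p q (c : cell X) (i : 'I_(len c)) :
    epath u v (p ++ bpath i ++ q) ->
    homotopic u v (p ++ bpath i ++ q) (p ++ q).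

Definition inv_path (X : complex) (p : seq (dart X)) : seq (dart X) :=
  rev (map (fun d => drev d) p).

Lemma epath_cat (X : complex) (u v : vert X) p q :
  epath u v (p ++ q) <-> exists w, epath u w p /\ epath w v q.
Proof.
elim: p u => [|d p IH] u /=.
  by split=> [h|[w [/eqP <-]]//]; exists u.
split=> [/andP[-> /IH [w [h1 h2]]]|[w [/andP[-> h1] h2]]] /=.
  by exists w.
by apply/IH; exists w.
Qed.

Lemma epath_catI (X : complex) (u v w : vert X) p q :
  epath u w p -> epath w v q -> epath u v (p ++ q).
Proof. by move=> h1 h2; apply/epath_cat; exists w. Qed.

Lemma epath_uniq (X : complex) (u v w : vert X) p :
  epath u v p -> epath u w p -> v = w.
Proof.
elim: p u => [|d p IH] u /=; first by move=> /eqP <- /eqP.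
by move=> /andP[_ h1] /andP[_]; exact: IH.
Qed.

Lemma dsrc_drev (X : complex) (d : dart X) : dsrc (drev d : dart X) = dtgt d.
Proof. by []. Qed.

Lemma dtgt_drev (X : complex) (d : dart X) : dtgt (drev d : dart X) = dsrc d.
Proof. by rewrite /dtgt drevK. Qed.

Lemma epath_inv (X : complex) (u v : vert X) p :
  epath u v p -> epath v u (inv_path p).
Proof.
elim: p u => [|d p IH] u /=; first by rewrite eq_sym.
move=> /andP[/eqP du /IH h]; rewrite /inv_path /= rev_cons -cats1.
by apply: epath_catI h _; rewrite /= dsrc_drev dtgt_drev du !eqxx.
Qed.

Lemma inv_pathK (X : complex) : involutive (@inv_path X).
Proof.
move=> p; rewrite /inv_path map_rev revK -map_comp.
by rewrite -[RHS]map_id; apply: eq_map => d /=; rewrite drevK.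
Qed.

Lemma inv_path_cat (X : complex) (p q : seq (dart X)) :
  inv_path (p ++ q) = inv_path q ++ inv_path p.
Proof. by rewrite /inv_path map_cat rev_cat. Qed.

Lemma bpathP (X : complex) (c : cell X) (i : 'I_(len c)) n :
  epath (dsrc (bd c i : dart X)) (dsrc (bd c (iter n (@ordS _) i) : dart X))
    [seq bd c (iter k (@ordS _) i) | k <- iota 0 n].
Proof.
elim: n => [|n IH]; first exact: eqxx.
rewrite -{2}addn1 iotaD map_cat; apply: epath_catI IH _.
by rewrite /= eqxx; exact/eqP/bd_closed.
Qed.

Lemma iter_ordS n (i : 'I_n) k : iter k (@ordS n) i = (i + k) %% n :> nat.
Proof.
elim: k => [|k IH] /=; first by rewrite addn0 modn_small.
by rewrite IH -addn1 modnDml addn1 addnS.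
Qed.

Lemma iter_ordS_n n (i : 'I_n) : iter n (@ordS n) i = i.
Proof. by apply: val_inj; rewrite /= iter_ordS modnDr modn_small. Qed.

Lemma epath_bpath (X : complex) (c : cell X) (i : 'I_(len c)) :
  epath (dsrc (bd c i : dart X)) (dsrc (bd c i : dart X)) (bpath i).
Proof. by have := bpathP i (len c); rewrite iter_ordS_n. Qed.

Lemma bpath_ends (X : complex) (u v : vert X) (c : cell X) (i : 'I_(len c)) :
  epath u v (bpath i) -> u = v.
Proof.
move=> h; have /eqP su : dsrc (bd c i : dart X) == u.
  move: h; rewrite /bpath; set n := (X in iota 0 X).
  by have: 0 < n by [exact: len_gt0]; case: n => //= n _ /andP[].
by apply: epath_uniq h; rewrite -su; exact: epath_bpath.
Qed.

Lemma homotopic_path (X : complex) (u v : vert X) p q :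
  homotopic u v p q -> epath u v p /\ epath u v q.
Proof.
elim=> {p q} [p //|p q _ []//|p q r _ [h _] _ [] //|p q d|p q c i] h;
  split=> //; case/epath_cat: h => a [ha /epath_cat[b [hb hq]]];
  apply: (epath_catI ha).
  by move: hb => /= /and3P[/eqP <- _]; rewrite dtgt_drev => /eqP ->.
by rewrite (bpath_ends hb).
Qed.

Lemma homotopic_catr (X : complex) (u v w : vert X) p q r :
  homotopic u v p q -> epath v w r -> homotopic u w (p ++ r) (q ++ r).
Proof.
move=> h hr; elim: h => {p q} [p h|p q _ IH|p q s _ IH1 _ IH2|p q d h|p q c i h].
- by apply: homotopic_refl; exact: epath_catI h hr.
- exact: homotopic_sym.
- exact: homotopic_trans IH2.
- have := epath_catI h hr; rewrite -!catA; exact: homotopic_backtrack.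
- have := epath_catI h hr; rewrite -!catA; exact: homotopic_cell.
Qed.

Lemma homotopic_catl (X : complex) (u v w : vert X) p q r :
  homotopic v w p q -> epath u v r -> homotopic u w (r ++ p) (r ++ q).
Proof.
move=> h hr; elim: h => {p q} [p h|p q _ IH|p q s _ IH1 _ IH2|p q d h|p q c i h].
- by apply: homotopic_refl; exact: epath_catI hr h.
- exact: homotopic_sym.
- exact: homotopic_trans IH2.
- have := epath_catI hr h; rewrite !(catA r); exact: homotopic_backtrack.
- have := epath_catI hr h; rewrite !(catA r); exact: homotopic_cell.
Qed.

Lemma homotopic_cat (X : complex) (u v w : vert X) p p' q q' :
  homotopic u v p p' -> homotopic v w q q' ->
  homotopic u w (p ++ q) (p' ++ q').
Proof.
move=> hp hq; have [_ p'P] := homotopic_path hp; have [qP _] := homotopic_path hq.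
exact: homotopic_trans (homotopic_catr hp qP) (homotopic_catl hq p'P).
Qed.

Lemma homotopic_invr (X : complex) (u v : vert X) p :
  epath u v p -> homotopic u u (p ++ inv_path p) [::].
Proof.
elim: p u => [|d p IH] u hp; first by apply: homotopic_refl; exact: eqxx.
have /= /andP[/eqP du hp'] := hp.
rewrite /inv_path /= rev_cons -cats1 catA -[d :: _]cat1s.
have du' : epath u (dtgt d) [:: d] by rewrite /= du !eqxx.
have ud : epath (dtgt d) u [:: drev d : dart X].
  by rewrite /= dtgt_drev du !eqxx.
apply: homotopic_trans (homotopic_catl (homotopic_catr (IH _ hp') ud) du') _.
apply: (@homotopic_backtrack X u u [::] [::] d).
by rewrite /= dsrc_drev dtgt_drev du !eqxx.
Qed.

Lemma homotopic_invl (X : complex) (u v : vert X) p :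
  epath u v p -> homotopic v v (inv_path p ++ p) [::].
Proof. by move=> /epath_inv/homotopic_invr; rewrite inv_pathK. Qed.

Lemma homotopic_inv (X : complex) (u v : vert X) p q :
  homotopic u v p q -> homotopic v u (inv_path p) (inv_path q).
Proof.
move=> h; have [hp hq] := homotopic_path h.
have hp' := epath_inv hp; have hq' := epath_inv hq.
apply: (homotopic_trans (q := inv_path p ++ (q ++ inv_path q))).
  apply: homotopic_sym.
  by have := homotopic_catl (homotopic_invr hq) hp'; rewrite cats0.
rewrite catA; apply: (homotopic_catr (q := [::])) hq'.
apply: homotopic_trans (homotopic_invl hp).
by apply: homotopic_catl hp'; exact: homotopic_sym.
Qed.

Lemma epath_map (Y X : complex) (f : cmap Y X) u v p :
  epath u v p -> epath (f u) (f v) [seq fdart f d | d <- p].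
Proof.
elim: p u => [|d p IH] u /=; first by move=> /eqP ->.
by move=> /andP[/eqP <- /IH]; rewrite dsrc_fdart dtgt_fdart eqxx.
Qed.

Lemma map_inv_path (Y X : complex) (f : cmap Y X) p :
  [seq fdart f d | d <- inv_path p] = inv_path [seq fdart f d | d <- p].
Proof.
rewrite /inv_path map_rev -!map_comp; congr rev; apply: eq_map => d /=.
exact: fdart_drev.
Qed.

Lemma map_bpath (Y X : complex) (f : cmap Y X) (c : cell Y) (i : 'I_(len c)) :
  exists j : 'I_(len (fcell f c)),
    [seq fdart f d | d <- bpath i] =
    if cflip f c then inv_path (bpath j) else bpath j.
Proof.
have fn := fcell_len f c; rewrite /bpath /inv_path.
case fc: (cflip f c); last first.
  exists (fside f i); rewrite -map_comp (congr1 (iota 0) fn).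
  apply: eq_map => k /=; rewrite fdart_bd fc dflip_false; congr bd.
  elim: k => //= k <-.
  by have := fside_cyc f (iter k (@ordS _) i); rewrite fc => ->.
exists (ordS (fside f i)); rewrite (congr1 (iota 0) fn); set n := len c.
have fsK k : iter k (@ordS _) (fside f (iter k (@ordS _) i)) = fside f i.
  elim: k => //= k <-; rewrite -iterS iterSr.
  by have := fside_cyc f (iter k (@ordS _) i); rewrite fc => ->.
apply: (@eq_from_nth _ (fdart f (bd c i))) => [|k].
  by rewrite size_rev !size_map.
rewrite !size_map !size_iota => kn.
rewrite nth_rev !size_map size_iota // -!map_comp.
have kn' : n - k.+1 < n by rewrite -subSn // subSS leq_subr.
rewrite !(nth_map 0) ?size_iota // !nth_iota //= !add0n fdart_bd fc dflip_true.
congr (drev (bd _ _)); rewrite -iterSr -subSn // subSS -[in RHS](fsK k) -iterD.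
rewrite subnK 1?ltnW //.
by rewrite (congr1 (fun m => iter m (@ordS _) _) (esym fn)) iter_ordS_n.
Qed.

Lemma homotopic_map (Y X : complex) (f : cmap Y X) u v p q :
  homotopic u v p q ->
  homotopic (f u) (f v) [seq fdart f d | d <- p] [seq fdart f d | d <- q].
Proof.
elim=> {p q} [p h|p q _ IH|p q s _ IH1 _ IH2|p q d h|p q c i h].
- by apply: homotopic_refl; exact: epath_map.
- exact: homotopic_sym.
- exact: homotopic_trans IH2.
- have := epath_map f h; rewrite !map_cat /= fdart_drev.
  exact: homotopic_backtrack.
- have := epath_map f h; rewrite !map_cat.
  have [j ->] := map_bpath f i; case: (cflip f c); last exact: homotopic_cell.
  case/epath_cat => a [ha /epath_cat[b [hb hq]]].
  apply: homotopic_catl ha; apply: (homotopic_catr (q := [::])) hq.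
  have hj := epath_inv hb; rewrite inv_pathK in hj; have ab := bpath_ends hj.
  rewrite {}ab in hj *; apply: (@homotopic_inv _ _ _ _ [::]).
  have := @homotopic_cell X a a [::] [::] _ j; rewrite /= !cats0; exact.
Qed.

(* The fundamental group: homotopy classes of closed edge paths. *)
Definition loop (X : complex) (x : vert X) : choiceType :=
  {p : seq (dart X) | epath x x p}.

Definition loop_equiv (X : complex) (x : vert X) (p q : loop x) : bool :=
  `[< homotopic x x (val p) (val q) >].

Fact loop_equiv_class (X : complex) (x : vert X) :
  equiv_class_of (@loop_equiv X x).
Proof.
split.
- by move=> p; apply/asboolP/homotopic_refl/(valP p).
- by move=> p q; apply/asboolP/asboolP => /homotopic_sym.
- by move=> q p r /asboolP pq /asboolP qr; apply/asboolP/(homotopic_trans pq).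
Qed.

Canonical loop_equiv_rel (X : complex) (x : vert X) : equiv_rel (loop x) :=
  EquivRelPack (loop_equiv_class x).

Definition pi1 (X : complex) (x : vert X) := {eq_quot loop_equiv_rel x}%qT.

HB.instance Definition _ (X : complex) (x : vert X) := Choice.on (pi1 x).

Definition pi1_class (X : complex) (x : vert X) (p : loop x) : pi1 x :=
  (\pi_(pi1 x) p)%qT.

Lemma pi1_classP (X : complex) (x : vert X) (p q : loop x) :
  pi1_class p = pi1_class q <-> homotopic x x (val p) (val q).
Proof.
split=> [/eqquotP/asboolP//|h]; exact/eqquotP/asboolP.
Qed.

Lemma pi1_reprK (X : complex) (x : vert X) (a : pi1 x) :
  pi1_class (repr a) = a.
Proof. exact: reprK. Qed.

Lemma pi1_ind (X : complex) (x : vert X) (P : pi1 x -> Prop) :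
  (forall p, P (pi1_class p)) -> forall a, P a.
Proof. by move=> h a; rewrite -(pi1_reprK a). Qed.

Definition loop1 (X : complex) (x : vert X) : loop x :=
  exist (epath x x) [::] (eqxx x).
Definition loopM (X : complex) (x : vert X) (p q : loop x) : loop x :=
  exist (epath x x) (val p ++ val q) (epath_catI (valP p) (valP q)).
Definition loopV (X : complex) (x : vert X) (p : loop x) : loop x :=
  exist (epath x x) (inv_path (val p)) (epath_inv (valP p)).

Definition pi1_one (X : complex) (x : vert X) : pi1 x := pi1_class (loop1 x).
Definition pi1_mul (X : complex) (x : vert X) (a b : pi1 x) : pi1 x :=
  pi1_class (loopM (repr a) (repr b)).
Definition pi1_inv (X : complex) (x : vert X) (a : pi1 x) : pi1 x :=
  pi1_class (loopV (repr a)).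

Lemma pi1_mulE (X : complex) (x : vert X) (p q : loop x) :
  pi1_mul (pi1_class p) (pi1_class q) = pi1_class (loopM p q).
Proof.
by apply/pi1_classP; apply: homotopic_cat; apply/pi1_classP; rewrite pi1_reprK.
Qed.

Lemma pi1_invE (X : complex) (x : vert X) (p : loop x) :
  pi1_inv (pi1_class p) = pi1_class (loopV p).
Proof. by apply/pi1_classP/homotopic_inv/pi1_classP; rewrite pi1_reprK. Qed.

Section Pi1Group.
Variables (X : complex) (x : vert X).

Fact pi1_mulA : associative (@pi1_mul X x).
Proof.
elim/pi1_ind=> p; elim/pi1_ind=> q; elim/pi1_ind=> r; rewrite !pi1_mulE.
by congr pi1_class; apply: val_inj; rewrite /= catA.
Qed.

Fact pi1_mul1 : left_id (pi1_one x) (@pi1_mul X x).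
Proof.
elim/pi1_ind=> p; rewrite pi1_mulE; congr pi1_class; exact: val_inj.
Qed.

Fact pi1_1mul : right_id (pi1_one x) (@pi1_mul X x).
Proof.
elim/pi1_ind=> p; rewrite pi1_mulE; congr pi1_class; apply: val_inj.
by rewrite /= cats0.
Qed.

Fact pi1_mulV : left_inverse (pi1_one x) (@pi1_inv X x) (@pi1_mul X x).
Proof.
elim/pi1_ind=> p; rewrite pi1_invE pi1_mulE; apply/pi1_classP.
exact: homotopic_invl (valP p).
Qed.

Fact pi1_Vmul : right_inverse (pi1_one x) (@pi1_inv X x) (@pi1_mul X x).
Proof.
elim/pi1_ind=> p; rewrite pi1_invE pi1_mulE; apply/pi1_classP.
exact: homotopic_invr (valP p).
Qed.

HB.instance Definition _ :=
  isGroup.Build (pi1 x) pi1_mulA pi1_mul1 pi1_1mul pi1_mulV pi1_Vmul.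

End Pi1Group.

Fact epath_map_based (Y X : complex) (f : cmap Y X) (y : vert Y) (x : vert X)
    (fy : f y = x) (p : loop y) : epath x x [seq fdart f d | d <- val p].
Proof. by rewrite -fy; exact: epath_map (valP p). Qed.

Definition loop_map (Y X : complex) (f : cmap Y X) (y : vert Y) (x : vert X)
    (fy : f y = x) (p : loop y) : loop x :=
  exist (epath x x) _ (epath_map_based fy p).

(* The map induced on fundamental groups by the based map [(Y, y) -> (X, x)]. *)
Definition pi1_map (Y X : complex) (f : cmap Y X) (y : vert Y) (x : vert X)
    (fy : f y = x) (a : pi1 y) : pi1 x :=
  pi1_class (loop_map fy (repr a)).

Lemma pi1_mapE (Y X : complex) (f : cmap Y X) (y : vert Y) (x : vert X)
    (fy : f y = x) (p : loop y) :
  pi1_map fy (pi1_class p) = pi1_class (loop_map fy p).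
Proof.
apply/pi1_classP => /=; rewrite -[in X in X _ _]fy.
by apply: homotopic_map; apply/pi1_classP; rewrite pi1_reprK.
Qed.

Definition pi1_injective (Y X : complex) (f : cmap Y X) : Prop :=
  forall y : vert Y, injective (@pi1_map Y X f y (f y) erefl).

Definition one_immersion (Y X : complex) (f : cmap Y X) : Prop :=
  forall d d' : dart Y, dsrc d = dsrc d' -> fdart f d = fdart f d' -> d = d'.

(* A combinatorial covering: a surjection that is bijective on the darts issuing
   from each 0-cell and on the sides present at each 1-cell, i.e. a local
   homeomorphism along the open cells of the 1-skeleton. *)
Definition covering (Xh X : complex) (p : cmap Xh X) : Prop :=
  [/\ forall x : vert X, exists v, p v = x,
      forall (v : vert Xh) (d : dart X), dsrc d = p v ->
        exists! d' : dart Xh, dsrc d' = v /\ fdart p d' = d &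
      forall (y : edge Xh) (s : side X), side_edge s = (fedge p y).1 ->
        exists! s' : side Xh, side_edge s' = y /\ side_map p s' = s].

(* The base 0-cells of Y, Y+ and X are [y], [i y] and [f y]; every 0-cell of X is
   allowed as a base point. *)
Definition perimeter_reduction (X : complex) (w : weight X) : Prop :=
  forall (Y : complex) (y : vert Y) (f : cmap Y X),
    compact Y -> connected Y -> one_immersion f ->
    ~ injective (@pi1_map Y X f y (f y) erefl) ->
    exists (Yp : complex) (i : cmap Y Yp) (fp : cmap Yp X)
           (fpy : fp (i y) = f y),
      [/\ cmap_eq f (cmap_comp fp i),
          compact Yp /\ connected Yp,
          perimeter w fp < perimeter w f &
          range (pi1_map fpy) = range (@pi1_map Y X f y (f y) erefl)].

Local Open Scope group_scope.

Definition generated (G : groupType) (A : set G) : set G :=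
  [set g | forall H : set G, group_closed [in H] -> A `<=` H -> H g].

Definition word (n : nat) := seq ('I_n * bool).

(* [(i, false)] stands for the i-th generator, [(i, true)] for its inverse. *)
Definition eval_word (G : groupType) (n : nat) (g : 'I_n -> G) (w : word n) : G :=
  \prod_(l <- w) (if l.2 then (g l.1)^-1 else g l.1).

Definition inv_word (n : nat) (w : word n) : word n := rev (map (@drev _) w).

(* The words representing the elements of the normal closure of [rels] in the
   free group of rank [n]. *)
Inductive normal_closure (n : nat) (rels : seq (word n)) : word n -> Prop :=
| nc_rel r : r \in rels -> normal_closure rels r
| nc_one : normal_closure rels [::]
| nc_mul u v :
    normal_closure rels u -> normal_closure rels v -> normal_closure rels (u ++ v)
| nc_inv u : normal_closure rels u -> normal_closure rels (inv_word u)
| nc_conj u v :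
    normal_closure rels u -> normal_closure rels (inv_word v ++ u ++ v)
| nc_reduce u v l : normal_closure rels (u ++ [:: l; drev l] ++ v) ->
    normal_closure rels (u ++ v)
| nc_expand u v l : normal_closure rels (u ++ v) ->
    normal_closure rels (u ++ [:: l; drev l] ++ v).

Definition finitely_generated (G : groupType) (H : set G) : Prop :=
  exists A : seq G, H = generated [set` A].

(* [H] is isomorphic to the group presented by [n] generators and the relators
   [rels]: the kernel of the evaluation map from the free group onto [H] is the
   normal closure of [rels]. *)
Definition finitely_presented (G : groupType) (H : set G) : Prop :=
  exists (n : nat) (g : 'I_n -> G) (rels : seq (word n)),
    H = generated (range g) /\
    forall u : word n, eval_word g u = 1 <-> normal_closure rels u.

Definition coherent (G : groupType) : Prop :=
  forall H : set G, finitely_generated H -> finitely_presented H.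

(* Main.v *)
Require Import Defs.
From mathcomp Require Import all_boot finmap all_classical.

(** Let [p : Xh -> X] be a covering and [Y] a compact connected subcomplex of
    [Xh] whose inclusion is not injective on fundamental groups. Then neither
    is the 1-immersion [Y -> X], so it factors as [Y -> Y+ -> X] where [Y+]
    has smaller perimeter and the same image in the fundamental group of [X].
    Because of the latter, [Y+ -> X] lifts to [Xh] ([lifting_criterion]), and
    the lift extends the inclusion of [Y], as lifts are unique
    ([lift_unique]). The image of the lift is a compact connected subcomplex
    that contains [Y]; passing from [Y+] to this image cannot increase the
    perimeter, since a side missing at a 1-cell of the image is missing at
    every 1-cell above it ([perimeter_image]). This is
    [perimeter_reduction_sub].

    Perimeters are natural numbers and every compact subcomplex lies in a
    compact connected one ([connected_hull]), so a minimum exists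
    ([minimal_subcomplex]). By the first part, a minimizer is injective on
    fundamental groups ([minimal_pi1_injective]).

    For coherence, let [H] be a finitely generated subgroup of the
    fundamental group of [X] and consider the covering space of the action on
    the cosets of [H] ([action_cover]), where the loops at the base point are
    the lifts of the loops of [X] with class in [H]. Finitely many loops
    representing generators of [H] lie in a compact subcomplex. A compact
    connected subcomplex [Y] that contains them and is injective on
    fundamental groups has [H] as the image of its fundamental group in that
    of [X]. The map is injective, as coverings are ([homotopic_lift]). So [H]
    is isomorphic to the fundamental group of a compact complex, which is
    finitely presented ([pi1_finitely_presented]). *)

Set Implicit Arguments.
Unset Strict Implicit.
Unset Printing Implicit Defensive.

Local Open Scope classical_set_scope.

(** * Sides of 2-cells and their behaviour under maps *)

Definition sdart (X : complex) (s : side X) : dart X := bd (tag s) (tagged s).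

(** Cyclic successors are compared as sides rather than as indices, since the
    indices of a 2-cell and of its image live in different types. *)
Definition snext (X : complex) (s : side X) : side X :=
  Tagged (fun c => 'I_(len c)) (ordS (tagged s)).

Lemma side_tagged_inj (X : complex) (c : cell X) (i j : 'I_(len c)) :
  Tagged (fun c : cell X => 'I_(len c)) i = Tagged (fun c => 'I_(len c)) j ->
  i = j.
Proof. by move=> /eqP; rewrite eq_Tagged => /eqP. Qed.

Lemma snext_inj (X : complex) : injective (@snext X).
Proof.
move=> [c i] [c' j] h.
have /= ecc' := congr1 (@tag _ _) h; case: c' / ecc' in j h *.
by have /= -> := ordS_inj (side_tagged_inj h).
Qed.

Lemma side_map_dart (Y X : complex) (f : cmap Y X) (s : side Y) :
  fdart f (sdart s) = dflip (cflip f (tag s)) (sdart (side_map f s)).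
Proof. exact: fdart_bd. Qed.

Lemma side_map_next (Y X : complex) (f : cmap Y X) (s : side Y) :
  if cflip f (tag s) then snext (side_map f (snext s)) = side_map f s
  else side_map f (snext s) = snext (side_map f s).
Proof.
have := fside_cyc f (tagged s); rewrite /side_map /snext /=.
by case: (cflip f _) => ->.
Qed.

Lemma ordS_transitive n (i j : 'I_n) : exists k, iter k (@ordS n) i = j.
Proof.
exists (j + (n - i)); apply: val_inj; rewrite /= iter_ordS addnCA subnKC.
  by rewrite modnDr modn_small.
exact: ltnW.
Qed.

(** The image is closed under the cyclic successor, whichever way the polygon
    is traversed. *)
Lemma fside_surj (Y X : complex) (f : cmap Y X) (c : cell Y)
    (j : 'I_(len (fcell f c))) : exists i, fside f (c := c) i = j.
Proof.
have [k <-] := ordS_transitive (fside f (Ordinal (len_gt0 c))) j.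
elim: k => [|k [i /= <-]]; first by eexists.
case fc: (cflip f c).
  exists (ord_pred i).
  by have := fside_cyc f (ord_pred i); rewrite fc ord_predK => ->.
by exists (ordS i); have := fside_cyc f i; rewrite fc.
Qed.

Lemma fside_inj (Y X : complex) (f : cmap Y X) (c : cell Y) :
  injective (@fside Y X f c).
Proof.
have [g gK] := choice (@fside_surj Y X f c).
have gI : injective g := can_inj gK.
have /(inj_card_bij gI)[h hK Kh] : #|'I_(len c)| <= #|'I_(len (fcell f c))|.
  by rewrite !card_ord fcell_len.
by move=> i j; rewrite -(Kh i) -(Kh j) !gK => ->.
Qed.

Lemma side_map_inj (Y X : complex) (f : cmap Y X) (s s' : side Y) :
  tag s = tag s' -> side_map f s = side_map f s' -> s = s'.
Proof.
case: s s' => c i [c' j] /= ecc'; case: c' / ecc' in j *.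
by move=> /side_tagged_inj/fside_inj /= ->.
Qed.

Lemma side_map_surj (Y X : complex) (f : cmap Y X) (c : cell Y) (s : side X) :
  fcell f c = tag s ->
  exists i : 'I_(len c), side_map f (Tagged (fun c => 'I_(len c)) i) = s.
Proof.
case: s => c' j /= ecc'; case: c' / ecc' in j *.
by have [i <-] := fside_surj j; exists i.
Qed.

(** A map that reverses the orientation of a 2-cell sends attaching paths to
    inverses of attaching paths; reading those as paths running backwards
    around the polygon identifies at which 0-cell the image path starts. *)
Lemma inv_bpath (X : complex) (c : cell X) (i : 'I_(len c)) :
  inv_path (bpath (ordS i)) =
  [seq drev (bd c (iter k (@ord_pred _) i)) | k <- iota 0 (len c)].
Proof.
have back k : k <= len c ->
    iter (len c - k) (@ordS _) i = iter k (@ord_pred _) i.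
  elim: k => [|k IH] kn; first by rewrite subn0 iter_ordS_n.
  by rewrite /= -IH 1?ltnW // subnS -[len c - k]prednK ?subn_gt0 //= ordSK.
apply: (@eq_from_nth _ (bd c i)) => [|k]; rewrite ?size_rev !size_map //.
rewrite size_iota => kn; rewrite /inv_path nth_rev !size_map size_iota //.
have kn' : len c - k.+1 < len c by rewrite -subSn // subSS leq_subr.
rewrite -map_comp !(nth_map 0) ?size_iota // !nth_iota //= !add0n -iterSr -subSn //.
by rewrite subSS back // ltnW.
Qed.

Lemma map_bpath_fwd (Y X : complex) (f : cmap Y X) (c : cell Y) (i : 'I_(len c)) :
  cflip f c = false -> [seq fdart f d | d <- bpath i] = bpath (fside f i).
Proof.
move=> fc; rewrite /bpath -map_comp (congr1 (iota 0) (fcell_len f c)).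
apply: eq_map => k /=; rewrite fdart_bd fc dflip_false; congr bd.
by elim: k => //= k <-; have := fside_cyc f (iter k (@ordS _) i); rewrite fc.
Qed.

Lemma map_bpath_bwd (Y X : complex) (f : cmap Y X) (c : cell Y) (i : 'I_(len c)) :
  cflip f c = true ->
  [seq fdart f d | d <- inv_path (bpath (ordS i))] = bpath (fside f i).
Proof.
move=> fc; rewrite inv_bpath /bpath -map_comp (congr1 (iota 0) (fcell_len f c)).
apply: eq_map => k /=; rewrite fdart_drev fdart_bd fc dflip_true drevK; congr bd.
elim: k => //= k <-.
by have := fside_cyc f (ord_pred (iter k (@ord_pred _) i)); rewrite fc ord_predK.
Qed.

Lemma homotopic_bpath (X : complex) (c : cell X) (i : 'I_(len c)) :
  homotopic (dsrc (bd c i : dart X)) (dsrc (bd c i : dart X)) (bpath i) [::].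
Proof.
have := epath_bpath i; rewrite -[bpath i]cats0; exact: (homotopic_cell (p := [::])).
Qed.

Lemma bpath_head (X : complex) (c : cell X) (i : 'I_(len c)) :
  exists q, bpath i = bd c i :: q.
Proof.
rewrite /bpath; set n := (X in iota 0 X).
by have: 0 < n by [exact: len_gt0]; case: n => // n _; eexists.
Qed.

(** * Lifting paths and homotopies *)

Lemma cmap_eq_dart (Y X : complex) (f g : cmap Y X) :
  cmap_eq f g -> forall d, fdart f d = fdart g d.
Proof. by case=> _ e _ d; rewrite /fdart e. Qed.

Lemma fdart_comp (Z Y X : complex) (g : cmap Y X) (f : cmap Z Y) d :
  fdart (cmap_comp g f) d = fdart g (fdart f d).
Proof. exact: esym (fdart_dflip g d.2 (fedge f d.1)). Qed.

Lemma map_fdart_comp (Z Y X : complex) (g : cmap Y X) (f : cmap Z Y) q :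
  [seq fdart (cmap_comp g f) d | d <- q] =
  [seq fdart g d | d <- [seq fdart f d | d <- q]].
Proof. by rewrite -map_comp; apply: eq_map => d; exact: fdart_comp. Qed.

Lemma dart_edge_inj (Y X : complex) (f : cmap Y X) (d d' : dart Y) :
  d.1 = d'.1 -> fdart f d = fdart f d' -> d = d'.
Proof.
case: d d' => e b [e' b'] /= <-; rewrite /fdart /dflip /= => -[].
by case: b b' (fedge f e) => [] [] [? []].
Qed.

Lemma epath_lift_uniq (Y X : complex) (f : cmap Y X) (u v v' : vert Y) p q :
  one_immersion f -> epath u v p -> epath u v' q ->
  [seq fdart f d | d <- p] = [seq fdart f d | d <- q] -> p = q /\ v = v'.
Proof.
move=> fI; elim: p q u => [|d p IH] [|d' q] u //=.
  by move=> /eqP <- /eqP.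
move=> /andP[/eqP du hp] /andP[/eqP d'u hq].
move=> /eqP; rewrite eqseq_cons => /andP[/eqP e1 /eqP e2].
have edd' : d = d' by apply: (fI _ _ _ e1); rewrite du.
by rewrite -edd' in hq *; have [-> ->] := IH _ _ hp hq e2.
Qed.

Lemma map_cat_inv (A B : Type) (f : A -> B) (s : seq A) (t1 t2 : seq B) :
  [seq f x | x <- s] = t1 ++ t2 ->
  exists s1 s2, [/\ s = s1 ++ s2, [seq f x | x <- s1] = t1 &
                    [seq f x | x <- s2] = t2].
Proof.
move=> e; exists (take (size t1) s), (drop (size t1) s).
by rewrite cat_take_drop map_take map_drop e take_size_cat // drop_size_cat.
Qed.

Section Covering.
Variables (Xh X : complex) (p : cmap Xh X).
Hypothesis pC : covering p.

Lemma covering_immersion : one_immersion p.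
Proof.
move=> d d' ed ef; have [_ h _] := pC.
have [d0 [_ d0U]] := h (dsrc d) (fdart p d) (dsrc_fdart p d).
by rewrite -(d0U d) // -(d0U d').
Qed.

Lemma dart_lift (v : vert Xh) (d : dart X) : dsrc d = p v ->
  exists d' : dart Xh, dsrc d' = v /\ fdart p d' = d.
Proof. by have [_ h _] := pC => /h[d' [? _]]; exists d'. Qed.

Lemma epath_lift (u : vert Xh) (b : vert X) q : epath (p u) b q ->
  exists v r, [/\ epath u v r, [seq fdart p d | d <- r] = q & p v = b].
Proof.
elim: q u => [|d q IH] u /=.
  by move=> /eqP <-; exists u, [::]; split=> //; exact: eqxx.
move=> /andP[/eqP/dart_lift[d' [d'u pd']] hq].
rewrite -pd' dtgt_fdart in hq; have [v [r [hr er pv]]] := IH _ hq.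
by exists v, (d' :: r); rewrite /= d'u eqxx hr pd' er.
Qed.

Lemma side_lift (d : dart Xh) (s : side X) : side_edge s = (fdart p d).1 ->
  exists s' : side Xh, side_edge s' = d.1 /\ side_map p s' = s.
Proof. by have [_ _ h] := pC => /h[s' [? _]]; exists s'. Qed.

(** The first dart of the path lifts, and the side that it carries lifts with
    it; the attaching path of the 2-cell on that side, read backwards if the
    covering map reverses that 2-cell, is the lift of the whole path. *)
Lemma bpath_lift (u : vert Xh) (c : cell X) (i : 'I_(len c)) :
  dsrc (bd c i : dart X) = p u ->
  exists2 r, [seq fdart p d | d <- r] = bpath i & homotopic u u r [::].
Proof.
move=> /dart_lift[d [<- pd]].
have [|[c' i'] [se sm]] := @side_lift d (Tagged (fun c => 'I_(len c)) i).
  by rewrite pd.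
have /= ecc' := congr1 (@tag _ _) sm; case: c / ecc' in i pd sm *.
move/side_tagged_inj: sm => sm; rewrite -sm in pd *.
have same : d = dflip (cflip p c') (bd c' i').
  apply: (@dart_edge_inj _ _ p); first exact: esym se.
  by rewrite fdart_dflip fdart_bd dflip_dflip addbb dflip_false.
case fc: (cflip p c') same => same.
  exists (inv_path (bpath (ordS i'))); first exact: map_bpath_bwd.
  rewrite same dflip_true [dsrc (drev _)]bd_closed.
  by apply: (@homotopic_inv _ _ _ _ [::]); exact: homotopic_bpath.
exists (bpath i'); first exact: map_bpath_fwd.
by rewrite same dflip_false; exact: homotopic_bpath.
Qed.

Definition lifts_along (a : vert X) (q r : seq (dart X)) : Prop :=
  forall u v q', p u = a -> epath u v q' -> [seq fdart p d | d <- q'] = q ->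
  exists2 r', [seq fdart p d | d <- r'] = r & homotopic u v q' r'.

(** By uniqueness of lifts, a single null-homotopic lift of [l] at each point
    over its origin makes the insertion and the deletion of [l] liftable. *)
Lemma lifts_along_delete (a b : vert X) (q1 l q2 : seq (dart X)) :
  (forall u, epath a (p u) q1 ->
     exists2 r, [seq fdart p d | d <- r] = l & homotopic u u r [::]) ->
  lifts_along a (q1 ++ l ++ q2) (q1 ++ q2) /\
  lifts_along a (q1 ++ q2) (q1 ++ l ++ q2).
Proof.
move=> null; split=> u v q' pu.
  move=> hq' /map_cat_inv[r1 [r' [e1 m1 /map_cat_inv[r0 [r2 [e2 m0 m2]]]]]].
  move: hq'; rewrite {}e1 {}e2 => /epath_cat[w [h1 /epath_cat[w' [h0 h2]]]].
  exists (r1 ++ r2); first by rewrite map_cat m1 m2.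
  have [|r mr hr] := null w; first by rewrite -pu -m1; exact: epath_map.
  have [hr' _] := homotopic_path hr.
  have [e0 ew] := epath_lift_uniq covering_immersion h0 hr' (etrans m0 (esym mr)).
  rewrite {}e0 {}ew in h2 *.
  by apply: homotopic_catl h1; apply: (homotopic_catr (q := [::])) h2.
move=> hq' /map_cat_inv[r1 [r2 [e1 m1 m2]]].
move: hq'; rewrite {}e1 => /epath_cat[w [h1 h2]].
have [|r mr hr] := null w; first by rewrite -pu -m1; exact: epath_map.
exists (r1 ++ r ++ r2); first by rewrite !map_cat m1 mr m2.
apply: homotopic_sym; apply: homotopic_catl h1.
exact: (homotopic_catr (q := [::])) h2.
Qed.

(** Homotopy being symmetric, the induction has to carry both directions. *)
Lemma homotopic_lifts_along (a b : vert X) (q r : seq (dart X)) :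
  homotopic a b q r -> lifts_along a q r /\ lifts_along a r q.
Proof.
elim=> {q r} [q hq|q r _ []//|q r s _ [qr rq] _ [rs sr]|q1 q2 d h|q1 q2 c i h].
- by split=> u v q' _ hq' <-; exists q' => //; exact: homotopic_refl.
- split=> u v q' pu hq'.
    move=> /(qr _ _ _ pu hq')[r' mr' hr']; have [_ r'P] := homotopic_path hr'.
    have [s' ms' hs'] := rs _ _ _ pu r'P mr'.
    by exists s' => //; exact: homotopic_trans hs'.
  move=> /(sr _ _ _ pu hq')[r' mr' hr']; have [_ r'P] := homotopic_path hr'.
  have [s' ms' hs'] := rq _ _ _ pu r'P mr'.
  by exists s' => //; exact: homotopic_trans hs'.
- apply: lifts_along_delete => // u hu; move: h => /epath_cat[w [hw /=]].
  rewrite -(epath_uniq hu hw) => /andP[/eqP/dart_lift[d' [d'u pd']] _].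
  exists [:: d'; drev d']; first by rewrite /= fdart_drev pd'.
  apply: (homotopic_backtrack (p := [::]) (q := [::])).
  by rewrite /= dsrc_drev dtgt_drev d'u !eqxx.
- apply: lifts_along_delete => // u hu; move: h => /epath_cat[w [hw]].
  rewrite -(epath_uniq hu hw) => hb; apply: bpath_lift; move: hb.
  by have [q0 ->] := bpath_head i; move=> /= /andP[/eqP].
Qed.

(** A homotopy between the images moves the lift of one of them along, and
    lifts of paths are unique. *)
Lemma homotopic_lift (u v v' : vert Xh) (q r : seq (dart Xh)) :
  epath u v q -> epath u v' r ->
  homotopic (p u) (p v) [seq fdart p d | d <- q] [seq fdart p d | d <- r] ->
  v = v' /\ homotopic u v q r.
Proof.
move=> hq hr /homotopic_lifts_along[h _].
have [r' mr' qr'] := h _ _ _ erefl hq erefl.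
have [_ r'P] := homotopic_path qr'.
by have [<- <-] := epath_lift_uniq covering_immersion r'P hr mr'.
Qed.

End Covering.

(** * Lifting maps *)

Section LiftMap.
Variables (Xh X : complex) (p : cmap Xh X).
Hypothesis pC : covering p.

Let pI := covering_immersion pC.

Lemma side_lift_uniq (s s' : side Xh) :
  side_edge s = side_edge s' -> side_map p s = side_map p s' -> s = s'.
Proof.
move=> ee em; have [_ _ h] := pC.
have [|s0 [_ s0U]] := h (side_edge s) (side_map p s).
  exact: (esym (congr1 fst (side_map_dart p s))).
by rewrite -(s0U s) // -(s0U s').
Qed.

Section Existence.
Variables (Z : complex) (f : cmap Z X) (z : vert Z) (v : vert Xh).
Hypothesis Zc : connected Z.
Hypothesis pv : p v = f z.
Hypothesis sub : forall l, epath z z l -> exists2 m, epath v v m &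
  homotopic (f z) (f z) [seq fdart f d | d <- l] [seq fdart p d | d <- m].

Let over (z' : vert Z) (u : vert Xh) : Prop := exists q r,
  [/\ epath z z' q, epath v u r & [seq fdart p d | d <- r] = [seq fdart f d | d <- q]].

Fact over_total z' : exists u, over z' u.
Proof.
have [q hq] := Zc.2 z z'; have := epath_map f hq; rewrite -pv.
by move=> /(epath_lift pC)[u [r [hr mr _]]]; exists u, q, r.
Qed.

(** Two ways of reaching [z'] differ by a loop, whose image lifts to the loop
    [m]; so the lift of the first path ends where [m] followed by the lift of
    the second one does. *)
Fact over_uniq z' u u' : over z' u -> over z' u' -> u = u'.
Proof.
move=> [q [r [hq hr mr]]] [q' [r' [hq' hr' mr']]].
have [m hm hom] := sub (epath_catI hq (epath_inv hq')).
suff h : homotopic (p v) (p u) [seq fdart p d | d <- r]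
           [seq fdart p d | d <- m ++ r'].
  by have [->] := homotopic_lift pC hr (epath_catI hm hr') h.
have hfq := epath_map f hq; have hfq' := epath_map f hq'.
have pu : p u = f z'.
  by apply: epath_uniq hfq; rewrite -mr -pv; exact: epath_map.
rewrite pu pv map_cat mr mr'.
apply: homotopic_trans (homotopic_catr hom hfq').
rewrite map_cat map_inv_path -catA -[X in homotopic _ _ X _]cats0.
exact: homotopic_catl (homotopic_sym (homotopic_invl hfq')) hfq.
Qed.

(** A 0-cell is lifted along any path from [z], and a 1-cell at the lift of
    its origin. A 2-cell is lifted at one of its sides; the covering property
    there provides the 2-cell of [Xh], and uniqueness of lifts of darts,
    carried around the boundary, shows that its attaching path is the
    expected one. *)
Lemma lifting_criterion : exists g : cmap Z Xh, g z = v /\ cmap_eq f (cmap_comp p g).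
Proof.
have [gv gvP] := choice over_total.
have gvE z' u : over z' u -> gv z' = u by apply: over_uniq.
have pgv z' : p (gv z') = f z'.
  have [q [r [hq hr mr]]] := gvP z'; apply: epath_uniq (epath_map f hq).
  by rewrite -mr -pv; exact: epath_map.
have dartP (d : dart Z) : exists d' : dart Xh, dsrc d' = gv (dsrc d) /\
    fdart p d' = fdart f d.
  by apply: dart_lift => //; rewrite dsrc_fdart pgv.
have dart_tgt (d : dart Z) (d' : dart Xh) : dsrc d' = gv (dsrc d) ->
    fdart p d' = fdart f d -> dtgt d' = gv (dtgt d).
  move=> sd' pd'; have [q [r [hq hr mr]]] := gvP (dsrc d).
  apply/esym/gvE; exists (rcons q d), (rcons r d').
  rewrite -!cats1 !map_cat mr /= pd'; split=> //.
    by apply: epath_catI hq _; rewrite /= !eqxx.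
  by apply: epath_catI hr _; rewrite /= sd' !eqxx.
have [ge geP] := choice (fun e => dartP (e, false)).
have ge_src e : dsrc (ge e) = gv (esrc e) by have [-> _] := geP e.
have ge_map e : fdart p (ge e) = fedge f e.
  by have [_ ->] := geP e; exact: dflip_false.
have ge_tgt e : dtgt (ge e) = gv (etgt e).
  by have [h1 h2] := geP e; exact: (dart_tgt (e, false)).
pose gd (d : dart Z) : dart Xh := dflip d.2 (ge d.1).
have gd_map d : fdart p (gd d) = fdart f d by rewrite fdart_dflip ge_map.
have gd_src d : dsrc (gd d) = gv (dsrc d).
  case: d => e [] /=; last by rewrite /gd dflip_false ge_src.
  exact: ge_tgt.
have gd_tgt d : dtgt (gd d) = gv (dtgt d) by apply: dart_tgt.
have cellP (c : cell Z) :
  exists t : {c' : cell Xh & ('I_(len c) -> 'I_(len c')) * bool}%type,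
  [/\ len (tag t) = len c,
   forall i, if (tagged t).2 then ordS ((tagged t).1 (ordS i)) = (tagged t).1 i
     else (tagged t).1 (ordS i) = ordS ((tagged t).1 i),
   forall i, gd (bd c i) = dflip (tagged t).2 (bd (tag t) ((tagged t).1 i)) &
   forall i, side_map p (Tagged (fun c => 'I_(len c)) ((tagged t).1 i)) =
     side_map f (Tagged (fun c => 'I_(len c)) i)].
  (* [S i] is the side to be lifted, [s0] the lift of the side number 0, and
     [fs i] the side of the 2-cell [c'] of [s0] that lies over [S i]. *)
  pose S i := side_map f (Tagged (fun c => 'I_(len c)) (i : 'I_(len c))).
  pose i0 := Ordinal (len_gt0 c).
  have [|s0 [es0 ms0]] := side_lift pC (d := gd (bd c i0)) (s := S i0).
    by rewrite gd_map fdart_bd.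
  pose c' := tag s0; have ec' : fcell p c' = fcell f c.
    by have := congr1 (@tag _ _) ms0.
  have [//|fs fsP] := choice (fun i => @side_map_surj _ _ p c' (S i) _).
  pose T (j : 'I_(len c')) := Tagged (fun c => 'I_(len c)) j.
  have TI j j' : side_map p (T j) = side_map p (T j') -> j = j'.
    by move=> /side_map_inj-/(_ erefl)/side_tagged_inj.
  have fs0 : T (fs i0) = s0 by apply: (side_map_inj (f := p)) => //; rewrite fsP.
  pose b := cflip p c' (+) cflip f c.
  have cyc i : if b then ordS (fs (ordS i)) = fs i else fs (ordS i) = ordS (fs i).
    have := side_map_next f (Tagged (fun c => 'I_(len c)) i); rewrite -!/(S _) /b /=.
    have := side_map_next p (T (fs i)); have := side_map_next p (T (fs (ordS i))).
    rewrite /= -![snext (T _)]/(T _) !fsP.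
    case: (cflip p c') (cflip f c) => [] [] /= h1 h2 h3; apply: TI; rewrite ?fsP.
    - apply: snext_inj; rewrite h2; exact: esym.
    - by apply: snext_inj; rewrite h1 -h3.
    - by rewrite h1.
    - by rewrite h2.
  have bdP i : gd (bd c i) = dflip b (bd c' (fs i)).
    have same_map j : fdart p (gd (bd c j)) = fdart p (dflip b (bd c' (fs j))).
      rewrite gd_map fdart_dflip fdart_bd.
      have -> := side_map_dart p (T (fs j)); rewrite fsP dflip_dflip.
      by rewrite /b /= [_ (+) cflip f c]addbC addbK.
    have [k <-] := ordS_transitive i0 i; elim: k => [|k /= IH].
      apply: (@dart_edge_inj _ _ p) => //; rewrite -es0.
      by rewrite -fs0.
    set j := iter k _ _ in IH *; apply: (pI _ (same_map _)).
    have -> : dsrc (gd (bd c (ordS j))) = dtgt (gd (bd c j)).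
      by rewrite gd_tgt gd_src; congr gv; exact: esym (bd_closed j).
    rewrite IH; have := cyc j; case: (b) => h.
      rewrite dflip_true dtgt_drev -h.
      exact: esym (bd_closed (fs (ordS j))).
    by rewrite !dflip_false h; exact: bd_closed.
  by exists (existT _ c' (fs, b)); split=> //=; rewrite -(fcell_len p) ec' fcell_len.
pose gc c := sval (cid (cellP c)); pose gcP c := svalP (cid (cellP c)).
have gc_len c : len (tag (gc c)) = len c by have [] := gcP c.
have gc_cyc c i : if (tagged (gc c)).2
    then ordS ((tagged (gc c)).1 (ordS i)) = (tagged (gc c)).1 i
    else (tagged (gc c)).1 (ordS i) = ordS ((tagged (gc c)).1 i).
  by have [_ h _ _] := gcP c; exact: h.
have gc_bd c i : dflip (bd c i).2 (ge (bd c i).1)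
    = dflip (tagged (gc c)).2 (bd (tag (gc c)) ((tagged (gc c)).1 i)).
  by have [_ _ h _] := gcP c; exact: h.
exists (CMap ge_src ge_tgt gc_len gc_cyc gc_bd); split.
  by apply: gvE; exists [::], [::]; rewrite /= !eqxx.
split=> [z'|e|[c i]]; [exact: esym (pgv z')|exact: esym (ge_map e)|].
by have [_ _ _ h] := gcP c; exact: esym (h i).
Qed.

End Existence.

(** Agreement spreads along paths to the 0-cells and 1-cells; a 2-cell is
    then determined by its image and the 1-cell at which one of its sides is
    present. *)
Lemma lift_unique (Y : complex) (g g' : cmap Y Xh) (y : vert Y) : connected Y ->
  cmap_eq (cmap_comp p g) (cmap_comp p g') -> g y = g' y -> cmap_eq g g'.
Proof.
move=> Yc pgg' gy.
have dartE d : fdart p (fdart g d) = fdart p (fdart g' d).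
  by rewrite -!fdart_comp; exact: cmap_eq_dart.
have vertE y' : g y' = g' y'.
  have [q hq] := Yc.2 y y'; have h := epath_map g hq; have h' := epath_map g' hq.
  rewrite -gy in h'; have [] := epath_lift_uniq pI h h' => //.
  by rewrite -!map_comp; exact: eq_map.
have gg' d : fdart g d = fdart g' d.
  by apply: (pI _ (dartE d)); rewrite !dsrc_fdart vertE.
split=> // [e|s].
  by have := gg' (e, false); rewrite /fdart !dflip_false.
apply: side_lift_uniq; last by case: pgg' => _ _ /(_ s).
have := congr1 fst (gg' (sdart s)).
by rewrite !side_map_dart.
Qed.

End LiftMap.

(** * Perimeters under surjections *)

Lemma leq_fsum (T : choiceType) (A B : set T) (F G : T -> nat) :
  finite_set (B `&` [set x | G x <> 0]) -> A `<=` B ->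
  (forall x, A x -> F x <= G x) ->
  \big[addn/0]_(x \in A) F x <= \big[addn/0]_(x \in B) G x.
Proof.
move=> fin AB FG; rewrite fsbig_mkcond [leqRHS]fsbig_mkcond.
have G0 x : x \notin fset_set (B `&` [set x | G x <> 0]) ->
    patch (fun=> 0) B G x = 0.
  rewrite in_fset_set // => /negP xN; rewrite patchE; case: ifPn => // /set_mem xB.
  by apply: contrapT => Gx; apply: xN; exact/mem_set.
have F_le x : patch (fun=> 0) A F x <= patch (fun=> 0) B G x.
  rewrite !patchE; case: ifPn => // /set_mem xA.
  by rewrite mem_set ?FG //; exact: AB.
rewrite (fsbigTE _ _ G0) (fsbigTE (fset_set (B `&` [set x | G x <> 0]))).
  by apply: leq_sum => x _; exact: F_le.
by move=> x /G0 Gx; have := F_le x; rewrite Gx leqn0 => /eqP.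
Qed.

(** A side that is present at a 1-cell remains present at its image, so the
    sides missing at the image of a 1-cell are missing at that 1-cell. *)
Lemma missing_image (Z A X : complex) (f : cmap Z X) (h : cmap Z A) (k : cmap A X)
    (z : edge Z) :
  cmap_eq f (cmap_comp k h) -> missing k (fedge h z).1 `<=` missing f z.
Proof.
move=> fkh s [se np]; have [ev ee es] := fkh; split; first by rewrite se ee.
move=> [rho [[rv re rs] rz]]; apply: np.
exists (cmap_comp h rho); split; last by rewrite -rz.
split=> [i|i|i]; first by rewrite -rv; exact: esym (ev _).
  rewrite -re; have hd := cmap_eq_dart fkh (fedge rho i).
  rewrite fdart_comp in hd; exact: esym hd.
by rewrite -rs; exact: esym (es (side_map rho i)).
Qed.

(** Choosing a 1-cell of [Z] over each 1-cell of [A] embeds the sum defining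
    the perimeter of [k] into the one defining the perimeter of [f]. *)
Lemma perimeter_image (X : complex) (w : weight X) (Z A : complex)
    (f : cmap Z X) (h : cmap Z A) (k : cmap A X) :
  compact Z -> (forall a, exists z, (fedge h z).1 = a) ->
  cmap_eq f (cmap_comp k h) -> perimeter w k <= perimeter w f.
Proof.
move=> [_ Zfin _] surj fkh; have [sec secK] := choice surj.
pose G z := \big[addn/0]_(s \in missing f z) w s.
have Gle a : \big[addn/0]_(s \in missing k a) w s <= G (sec a).
  apply: leq_fsum => //; last by rewrite -[a in missing k a]secK; exact: missing_image.
  apply: sub_finite_set (perim_edge_fin w (fedge f (sec a)).1).
  by move=> s [[]].
have GB B : finite_set (B `&` [set z | G z <> 0]).
  exact: sub_finite_set Zfin.
rewrite /perimeter -/G.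
apply: (@leq_trans (\big[addn/0]_(z \in range sec) G z)); last exact: leq_fsum.
rewrite fsbig_image; last by move=> a b _ _ ab; rewrite -(secK a) ab secK.
apply: leq_fsum => //; apply: (@sub_finite_set _ _ [set: edge A]) => //.
have -> : [set: edge A] = [set (fedge h z).1 | z in [set: edge Z]].
  by apply/seteqP; split=> // a _; exists (sec a).
exact: finite_image.
Qed.

(** * The image of a map *)

Section Image.
Variables (Z X : complex) (g : cmap Z X).

Let iv : set (vert X) := range g.
Let ie : set (edge X) := [set (fedge g e).1 | e in [set: edge Z]].
Let ic : set (cell X) := range (fcell g).

Fact image_dart (d : dart X) : ie d.1 -> iv (dsrc d).
Proof.
move=> [e _ ed]; case: (eqVneq (fedge g e).2 d.2) => [eb|nb].
  exists (esrc e) => //; rewrite -fedge_src; congr dsrc.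
  by rewrite [LHS]surjective_pairing ed eb -surjective_pairing.
exists (etgt e) => //; rewrite -fedge_tgt; congr dsrc.
rewrite [RHS]surjective_pairing /drev ed; congr pair.
by case: (_.2) (d.2) nb => [] [].
Qed.

Fact image_src e : ie e -> iv (esrc e).
Proof. exact: (@image_dart (e, false)). Qed.

Fact image_tgt e : ie e -> iv (etgt e).
Proof. exact: (@image_dart (e, true)). Qed.

Fact image_bd c (i : 'I_(len c)) : ic c -> ie (bd c i).1.
Proof.
move=> [c' _ ecc']; case: c / ecc' in i *; have [j <-] := fside_surj i.
by exists (bd c' j).1 => //; have := fdart_bd g j; rewrite /fdart /dflip => -[].
Qed.

Definition image : subcomplex X := Subcomplex image_src image_tgt image_bd.

Let cv (v : vert Z) : vert (complex_of image) :=
  exist _ (g v) (mem_set (imageT g v)).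
Let ce (e : edge Z) : dart (complex_of image) :=
  (exist _ (fedge g e).1 (mem_set (imageT (fun e => (fedge g e).1) e)), (fedge g e).2).
Let cc (c : cell Z) : cell (complex_of image) :=
  exist _ (fcell g c) (mem_set (imageT (fcell g) c)).

Fact corestrict_src e : dsrc (ce e) = cv (esrc e).
Proof.
apply: val_inj; rewrite [LHS]val_dstart /= -fedge_src.
by rewrite -surjective_pairing.
Qed.

Fact corestrict_tgt e : dtgt (ce e) = cv (etgt e).
Proof. by apply: val_inj; rewrite [LHS]val_dstart /= -fedge_tgt. Qed.

Fact corestrict_bd c (i : 'I_(len c)) :
  dflip (bd c i).2 (ce (bd c i).1) = dflip (cflip g c) (bd (cc c) (fside g i)).
Proof.
have := fside_bd g i; rewrite /dflip => -[e1 e2].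
by congr pair; [exact: val_inj|].
Qed.

Definition corestrict : cmap Z (complex_of image) :=
  @CMap Z (complex_of image) cv ce cc (fun c i => fside g i) (cflip g)
    corestrict_src corestrict_tgt (fcell_len g) (fside_cyc g) corestrict_bd.

Lemma corestrict_edge (a : edge (complex_of image)) :
  exists z, (fedge corestrict z).1 = a.
Proof.
by have [z _ za] := set_mem (valP a); exists z; apply: val_inj.
Qed.

Lemma compact_image : compact Z -> compact (complex_of image).
Proof.
move=> [Zv Ze Zc]; split.
- apply: sub_finite_set (finite_image cv Zv) => -[v vP] _.
  by have [z _ zv] := set_mem vP; exists z => //; exact: val_inj.
- apply: sub_finite_set (finite_image (fun e => (ce e).1) Ze) => a _.
  by have [z za] := corestrict_edge a; exists z.
- apply: sub_finite_set (finite_image cc Zc) => -[c cP] _.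
  by have [z _ zc] := set_mem cP; exists z => //; exact: val_inj.
Qed.

Lemma connected_image : connected Z -> connected (complex_of image).
Proof.
move=> [[z] Zc]; split; first exact: (inhabits (cv z)).
have cvP (u : vert (complex_of image)) : exists z', cv z' = u.
  by have [z' _ zu] := set_mem (valP u); exists z'; exact: val_inj.
move=> u v; have [u' <-] := cvP u; have [v' <-] := cvP v.
have [q hq] := Zc u' v'; eexists; exact: (epath_map corestrict hq).
Qed.

End Image.

(** * Reducing the perimeter inside a covering space *)

Lemma pi1_map_injP (Y X : complex) (f : cmap Y X) (y : vert Y) (x : vert X)
    (fy : f y = x) :
  injective (pi1_map fy) <-> forall l l', epath y y l -> epath y y l' ->
    homotopic x x [seq fdart f d | d <- l] [seq fdart f d | d <- l'] ->
    homotopic y y l l'.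
Proof.
split=> [inj l l' hl hl' h|inj].
  pose a : loop y := exist _ l hl; pose b : loop y := exist _ l' hl'.
  by apply/(pi1_classP a b)/inj; rewrite !pi1_mapE; exact/pi1_classP.
elim/pi1_ind=> l; elim/pi1_ind=> l'; rewrite !pi1_mapE => /pi1_classP h.
by apply/pi1_classP; apply: inj => //; [exact: valP|exact: valP].
Qed.

Lemma sub_incl_dart (X : complex) (A : subcomplex X) (d : dart (complex_of A)) :
  fdart (sub_incl A) d = (val d.1, d.2).
Proof. by rewrite /fdart /dflip /= addbF. Qed.

Lemma sub_incl_immersion (X : complex) (A : subcomplex X) :
  one_immersion (sub_incl A).
Proof.
move=> [e b] [e' b'] _; rewrite !sub_incl_dart => -[/val_inj -> ->].
by [].
Qed.

Section Reduction.
Variables (X : complex) (w : weight X) (Xh : complex) (p : cmap Xh X).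
Hypothesis pC : covering p.
Hypothesis PR : perimeter_reduction w.

(** A perimeter-reducing factorization of [Y -> X] has the same image in the
    fundamental group as [Y], so it lifts to the covering space; its image
    there is the required subcomplex. *)
Lemma perimeter_reduction_sub (Y : subcomplex Xh) :
  compact (complex_of Y) -> connected (complex_of Y) ->
  ~ pi1_injective (sub_incl Y) ->
  exists Y' : subcomplex Xh,
    [/\ compact (complex_of Y'), connected (complex_of Y'),
        subcomplex_le Y Y' &
        perimeter w (cmap_comp p (sub_incl Y')) <
        perimeter w (cmap_comp p (sub_incl Y))].
Proof.
move=> Ycp Ycn /existsNP[y yN]; pose f := cmap_comp p (sub_incl Y).
have fI : one_immersion f.
  move=> d d' sdd'; rewrite !fdart_comp => h; apply: sub_incl_immersion (sdd') _.
  by apply: (covering_immersion pC) h; rewrite !dsrc_fdart sdd'.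
have [|Yp [i [fp [fpy [fE [Zcp Zcn] Plt rE]]]]] := @PR _ y f Ycp Ycn fI.
  move=> /pi1_map_injP inj; apply: yN; apply/pi1_map_injP => l l' hl hl' h.
  by apply: inj => //; rewrite !map_fdart_comp; exact: (homotopic_map p h).
have [||g [gy fpE]] := lifting_criterion pC (f := fp) (z := i y)
    (v := sub_incl Y y) Zcn _ _.
- exact: esym fpy.
- move=> l hl; have : range (pi1_map fpy) (pi1_map fpy (pi1_class (exist _ l hl))).
    exact: imageT.
  rewrite rE => -[]; elim/pi1_ind=> m _; rewrite !pi1_mapE => /pi1_classP h.
  exists [seq fdart (sub_incl Y) d | d <- val m]; first exact: epath_map (valP m).
  rewrite fpy; apply: homotopic_sym.
  by rewrite -map_fdart_comp.
have giE : cmap_eq (sub_incl Y) (cmap_comp g i).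
  apply: (lift_unique pC (y := y)) => //.
  have [fv fe fs] := fE; have [gv ge gs] := fpE; split=> [v|e|s].
  - exact: etrans (fv v) (gv (i v)).
  - apply: etrans (fe e) (etrans (cmap_eq_dart fpE (fedge i e)) _).
    exact: fdart_comp.
  - exact: etrans (fs s) (gs (side_map i s)).
have [gv ge gs] := giE.
exists (image g); split.
- exact: compact_image.
- exact: connected_image.
- split=> [v vY|e eY|c cY].
  + by exists (i (exist _ v (mem_set vY))) => //; exact: esym (gv _).
  + exists (fedge i (exist _ e (mem_set eY))).1 => //.
    exact: esym (congr1 fst (ge _)).
  + pose c' : cell (complex_of Y) := exist _ c (mem_set cY).
    exists (fcell i c') => //.
    exact: esym (congr1 (@tag _ _) (gs (Tagged _ (Ordinal (len_gt0 c'))))).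
apply: leq_ltn_trans Plt.
by apply: perimeter_image Zcp (corestrict_edge (g := g)) _; exact: fpE.
Qed.

End Reduction.

(** * Compact connected subcomplexes *)

Lemma finite_sub_type (T : choiceType) (A : set T) :
  finite_set A <-> finite_set [set: A].
Proof.
split=> [Afin|fin].
  have /finite_seqP[s sA] := Afin.
  apply: sub_finite_set (finite_seq (pmap (insub : T -> option A) s)) => x _ /=.
  rewrite mem_pmap_sub; move: (val x) (set_mem (valP x)) => y.
  by rewrite sA.
apply: sub_finite_set (finite_image val fin) => x xA.
by exists (exist _ x (mem_set xA)).
Qed.

Lemma compact_subP (X : complex) (A : subcomplex X) : compact (complex_of A) <->
  [/\ finite_set (svert A), finite_set (sedge A) & finite_set (scell A)].
Proof.
have [hv ev] := finite_sub_type (svert A).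
have [he ee] := finite_sub_type (sedge A).
have [hc ec] := finite_sub_type (scell A).
by split=> -[? ? ?]; split; auto.
Qed.

Section AddDarts.
Variables (X : complex) (C : subcomplex X) (b : vert X) (D : seq (dart X)).

Let av : set (vert X) :=
  [set v | svert C v \/ v = b \/ exists2 d, d \in D & v = dsrc d \/ v = dtgt d].
Let ae : set (edge X) := [set e | sedge C e \/ exists2 d, d \in D & e = d.1].

Fact add_darts_end (d : dart X) : ae d.1 -> av (dsrc d).
Proof.
case=> [dC|[d' d'D dd']].
  left; case: d dC => e [] /=; [exact: sedge_tgt|exact: sedge_src].
right; right; exists d' => //.
case: d d' dd' {d'D} => e [] [e' []] /= ->; by [left|right].
Qed.

Fact add_darts_src e : ae e -> av (esrc e).
Proof. exact: (@add_darts_end (e, false)). Qed.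

Fact add_darts_tgt e : ae e -> av (etgt e).
Proof. exact: (@add_darts_end (e, true)). Qed.

Fact add_darts_bd c (i : 'I_(len c)) : scell C c -> ae (bd c i).1.
Proof. by move=> cC; left; exact: scell_bd. Qed.

Definition add_darts : subcomplex X :=
  Subcomplex add_darts_src add_darts_tgt add_darts_bd.

Lemma add_darts_le : subcomplex_le C add_darts.
Proof. by split=> // x; left. Qed.

Lemma compact_add_darts : compact (complex_of C) -> compact (complex_of add_darts).
Proof.
move=> /compact_subP[Cv Ce Cc]; apply/compact_subP; split=> //.
- apply: (@sub_finite_set _ _
      (svert C `|` [set` b :: map (@dsrc X) D ++ map (@dtgt X) D])).
    move=> v [vC|[->|[d dD vd]]]; [by left|by right; exact: mem_head|right].
    rewrite /= inE mem_cat; apply/orP; right; apply/orP.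
    by case: vd => ->; [left|right]; exact: map_f.
  by rewrite finite_setU; split=> //; exact: finite_seq.
- apply: (@sub_finite_set _ _ (sedge C `|` [set` map fst D])).
    by move=> e [eC|[d dD ->]]; [left|right; exact: map_f].
  by rewrite finite_setU; split=> //; exact: finite_seq.
Qed.

End AddDarts.

Lemma epath_sub (X : complex) (A : subcomplex X) (u v : vert X) q (uA : svert A u) :
  epath u v q -> (forall d, d \in q -> sedge A d.1) ->
  exists (vA : svert A v) r,
    epath (exist _ u (mem_set uA) : vert (complex_of A)) (exist _ v (mem_set vA)) r
    /\ [seq fdart (sub_incl A) d | d <- r] = q.
Proof.
elim: q u uA => [|d q IH] u uA /=.
  move=> /eqP uv _; case: v / uv; exists uA, [::]; split=> //; exact: eqxx.
move=> /andP[/eqP du hq] qA; have dA := qA d (mem_head _ _).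
pose d' : dart (complex_of A) := (exist _ d.1 (mem_set dA), d.2).
have dd' : fdart (sub_incl A) d' = d.
  by rewrite sub_incl_dart /= -surjective_pairing.
have sd' : val (dsrc d') = dsrc d.
  by have := dsrc_fdart (sub_incl A) d'; rewrite dd' => ->.
have td' : val (dtgt d') = dtgt d.
  by have := dtgt_fdart (sub_incl A) d'; rewrite dd' => ->.
have tA : svert A (dtgt d) by rewrite -td'; exact: set_mem (valP (dtgt d')).
have [|vA [r [hr mr]]] := IH _ tA hq.
  by move=> d0 d0q; apply: qA; rewrite inE d0q orbT.
exists vA, (d' :: r); split; last by rewrite /= dd' mr.
rewrite /=; apply/andP; split.
  by apply/eqP/val_inj; rewrite sd'.
by move: hr; congr (is_true (epath _ _ _)); exact: val_inj.
Qed.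

(** Any compact subcomplex is completed to a compact connected one by joining
    each of its 0-cells to a base point. *)
Lemma connected_hull (X : complex) (C : subcomplex X) :
  connected X -> compact (complex_of C) ->
  exists Y : subcomplex X,
    [/\ compact (complex_of Y), connected (complex_of Y) & subcomplex_le C Y].
Proof.
move=> [[b] Xc] Ccp; have /compact_subP[Cv _ _] := Ccp.
have /finite_seqP[s sC] := Cv; have [q hq] := choice (Xc b).
pose D := flatten [seq q v | v <- s]; pose Y := add_darts C b D.
have bY : svert Y b by right; left.
exists Y; split; [exact: compact_add_darts| |exact: add_darts_le].
split; first exact: (inhabits (exist _ b (mem_set bY))).
pose b' : vert (complex_of Y) := exist _ b (mem_set bY).
suff reach v : exists r, epath b' v r.
  move=> u v; have [r hr] := reach u; have [r' hr'] := reach v.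
  by exists (inv_path r ++ r'); apply: epath_catI (epath_inv hr) hr'.
suff [r [hr rD]] : exists r, epath b (val v) r /\ {subset r <= D}.
  have [|vY [r' [hr' _]]] := epath_sub bY hr.
    by move=> d /rD dD; right; exists d.
  exists r'; move: hr'; congr (is_true (epath _ _ _)); exact: val_inj.
have sD u : u \in s -> {subset q u <= D}.
  by move=> us d dq; apply/flattenP; exists (q u) => //; exact: map_f.
case: (set_mem (valP v)) => [vC|[->|[d dD vd]]].
- by exists (q (val v)); split; [exact: hq|apply: sD; move: vC; rewrite sC].
- by exists [::]; split=> //; exact: eqxx.
have /flattenP[_ /mapP[u us ->] dq] := dD.
have := hq u; move: dq (sD u us) => /path.splitPr[q1 q2] qD.
move=> /epath_cat[u' [h1 /= /andP[/eqP du' h2]]].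
case: vd => ->.
  by exists q1; rewrite du'; split=> // e eq1; apply: qD; rewrite mem_cat eq1.
exists (rcons q1 d); split.
  by rewrite -cats1; apply: epath_catI h1 _; rewrite /= du' !eqxx.
by move=> e; rewrite -cats1 => eq1; apply: qD; rewrite -cat1s catA mem_cat eq1.
Qed.

Lemma minimal_subcomplex (X Xh : complex) (w : weight X) (p : cmap Xh X)
    (C : subcomplex Xh) :
  connected Xh -> compact (complex_of C) ->
  exists Y : subcomplex Xh,
    [/\ compact (complex_of Y), connected (complex_of Y), subcomplex_le C Y &
        forall Y' : subcomplex Xh,
          compact (complex_of Y') -> connected (complex_of Y') ->
          subcomplex_le C Y' ->
          perimeter w (cmap_comp p (sub_incl Y)) <=
          perimeter w (cmap_comp p (sub_incl Y'))].
Proof.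
move=> Xc Ccp; pose P (Y : subcomplex Xh) := perimeter w (cmap_comp p (sub_incl Y)).
pose ok n := `[< exists Y, [/\ compact (complex_of Y), connected (complex_of Y),
  subcomplex_le C Y & P Y = n] >].
have [Y0 [cp0 cn0 le0]] := connected_hull Xc Ccp.
have ex_ok : exists n, ok n by exists (P Y0); apply/asboolP; exists Y0.
case: (ex_minnP ex_ok) => n /asboolP[Y [cp cn le PY]] min.
by exists Y; split=> // Y' cp' cn' le'; rewrite -!/(P _) PY; apply/min/asboolP; exists Y'.
Qed.

(** * Reading edge paths in the fundamental group *)

Lemma pi1_mulgE (X : complex) (x : vert X) (p q : loop x) :
  (pi1_class p * pi1_class q)%g = pi1_class (loopM p q).
Proof. exact: pi1_mulE. Qed.

Lemma pi1_invgE (X : complex) (x : vert X) (p : loop x) :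
  ((pi1_class p)^-1)%g = pi1_class (loopV p).
Proof. exact: pi1_invE. Qed.

Lemma pi1_mapM (Y X : complex) (f : cmap Y X) (y : vert Y) (x : vert X)
    (fy : f y = x) : {morph pi1_map fy : a b / (a * b)%g}.
Proof.
elim/pi1_ind=> p; elim/pi1_ind=> q; rewrite pi1_mulgE !pi1_mapE pi1_mulgE.
by congr pi1_class; apply: val_inj; rewrite /= map_cat.
Qed.

Lemma homotopic_mid (X : complex) (u a b v : vert X) q m r :
  epath u a q -> homotopic a b m [::] -> epath b v r ->
  homotopic u v (q ++ m ++ r) (q ++ r).
Proof.
move=> hq hm hr; apply: homotopic_catl hq.
exact: (homotopic_catr (q := [::])) hr.
Qed.

(** The trivial choice at the base point makes every loop there represent its
    own class in [path_class] below. *)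
Lemma based_paths (X : complex) (x : vert X) : connected X ->
  exists2 tau : vert X -> seq (dart X),
    forall v, epath x v (tau v) & tau x = [::].
Proof.
move=> [_ /(_ x)/choice[t tP]].
exists (fun v => if v == x then [::] else t v); last by rewrite eqxx.
by move=> v; case: eqP => [->|//]; exact: eqxx.
Qed.

Section BasedPaths.
Variables (X : complex) (x : vert X) (tau : vert X -> seq (dart X)).
Hypothesis tauP : forall v, epath x v (tau v).
Hypothesis tau_base : tau x = [::].

Definition detour (d : dart X) : seq (dart X) :=
  tau (dsrc d) ++ d :: inv_path (tau (dtgt d)).

Fact detour_path d : epath x x (detour d).
Proof.
apply: epath_catI (tauP _) _; rewrite /= eqxx /=.
exact: epath_inv (tauP _).
Qed.

Definition dart_class (d : dart X) : pi1 x :=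
  pi1_class (exist (epath x x) _ (detour_path d)).

(** The morphism from the groupoid of edge paths to the fundamental group
    that collapses the chosen paths [tau]. *)
Definition path_class (q : seq (dart X)) : pi1 x :=
  (\prod_(d <- q) dart_class d)%g.

(** The product telescopes: each inner path [tau] is followed by its inverse. *)
Lemma path_classE u v q (h : epath u v q) (l : loop x) :
  val l = tau u ++ q ++ inv_path (tau v) -> path_class q = pi1_class l.
Proof.
rewrite /path_class; elim: q u h l => [|d q IH] u h l lE.
  rewrite big_nil; apply/pi1_classP; rewrite lE.
  by move/eqP: h => <- /=; exact/homotopic_sym/homotopic_invr/tauP.
move: h => /= /andP[/eqP du hq].
have hl' : epath x x (tau (dtgt d) ++ q ++ inv_path (tau v)).
  by apply: epath_catI (tauP _) _; apply: epath_catI hq (epath_inv (tauP v)).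
rewrite big_cons (IH _ hq (exist (epath x x) _ hl')) //.
rewrite pi1_mulgE; apply/esym/pi1_classP; rewrite lE [val _]/= /detour du.
suff: homotopic x x ((tau u ++ [:: d]) ++
    (inv_path (tau (dtgt d)) ++ tau (dtgt d)) ++ (q ++ inv_path (tau v)))
    ((tau u ++ [:: d]) ++ (q ++ inv_path (tau v))).
  by move/homotopic_sym; rewrite -!catA.
apply: (@homotopic_mid _ x (dtgt d) (dtgt d)).
- by apply: epath_catI (tauP u) _; rewrite /= du !eqxx.
- exact: homotopic_invl (tauP _).
- by apply: epath_catI hq (epath_inv (tauP v)).
Qed.

Lemma path_class_loop (l : loop x) : path_class (val l) = pi1_class l.
Proof. by apply: path_classE (valP l) _ _; rewrite tau_base cats0. Qed.

Lemma path_class_homotopic u v q r :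
  homotopic u v q r -> path_class q = path_class r.
Proof.
move=> h; have [hq hr] := homotopic_path h.
have close s : epath u v s -> epath x x (tau u ++ s ++ inv_path (tau v)).
  by move=> hs; apply: epath_catI (tauP _) (epath_catI hs (epath_inv (tauP v))).
rewrite (path_classE hq (l := exist (epath x x) _ (close _ hq))) //.
rewrite (path_classE hr (l := exist (epath x x) _ (close _ hr))) //.
apply/pi1_classP; apply: homotopic_catl (tauP u).
exact: homotopic_catr h (epath_inv (tauP v)).
Qed.

Lemma path_class_cat q r : path_class (q ++ r) = (path_class q * path_class r)%g.
Proof. exact: big_cat. Qed.

Lemma path_class_tau v : path_class (tau v) = 1%g.
Proof.
have h : epath x x (tau v ++ inv_path (tau v)).
  exact: epath_catI (tauP v) (epath_inv (tauP v)).
rewrite (path_classE (tauP v) (l := exist (epath x x) _ h)) ?tau_base //.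
by apply/pi1_classP; exact: homotopic_invr (tauP v).
Qed.

Lemma dart_class_drev (d : dart X) : dart_class (drev d) = (dart_class d)^-1%g.
Proof.
rewrite /dart_class [RHS]pi1_invgE; congr pi1_class; apply: val_inj => /=.
rewrite /detour dsrc_drev dtgt_drev -[d :: _]cat1s !inv_path_cat inv_pathK.
by rewrite -catA.
Qed.

(** Every product of classes of darts, not only of consecutive ones, is the
    class of a loop. *)
Lemma path_class_detours q : exists2 l : loop x,
  val l = flatten [seq detour d | d <- q] & path_class q = pi1_class l.
Proof.
elim: q => [|d q [l lE IH]]; first by exists (loop1 x) => //; exact: big_nil.
exists (loopM (exist (epath x x) _ (detour_path d)) l); first by rewrite /= lE.
by rewrite /path_class big_cons -/(path_class q) IH pi1_mulgE.
Qed.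

Lemma path_class_bpath (c : cell X) (i : 'I_(len c)) : path_class (bpath i) = 1%g.
Proof. by rewrite (path_class_homotopic (homotopic_bpath i)); exact: big_nil. Qed.

End BasedPaths.

(** * Finite presentations of fundamental groups of compact complexes *)

Section NormalClosure.
Variables (n : nat) (rels : seq (word n)).
Local Notation N := (normal_closure rels).

Lemma nc_cancel a b w : N (a ++ w ++ inv_word w ++ b) <-> N (a ++ b).
Proof.
elim/last_ind: w b => [//|w l IH] b.
rewrite /inv_word map_rcons rev_rcons -cats1 -!catA /=.
rewrite -[_ :: _ :: _]/([:: l; drev l] ++ _).
rewrite -(IH b); split; rewrite !(catA a); [exact: nc_reduce|exact: nc_expand].
Qed.

Lemma inv_wordK : involutive (@inv_word n).
Proof.
move=> u; rewrite /inv_word map_rev revK -map_comp -[RHS]map_id.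
by apply: eq_map => l /=; rewrite drevK.
Qed.

(** The word [a r b] is the product of the conjugate [a r a^-1] with [a b]. *)
Lemma nc_insert r a b : N r -> N (a ++ r ++ b) <-> N (a ++ b).
Proof.
have conj s : N s -> N (a ++ s ++ inv_word a).
  by move/nc_conj => /(_ (inv_word a)); rewrite inv_wordK.
have cancelV c d w : N (c ++ inv_word w ++ w ++ d) <-> N (c ++ d).
  by have := nc_cancel c d (inv_word w); rewrite inv_wordK.
move=> Nr; split=> h.
  have := nc_mul (conj _ (nc_inv Nr)) h.
  rewrite -!catA catA => /cancelV; rewrite -catA; exact: (cancelV _ _ _).1.
have := nc_mul (conj _ Nr) h.
by rewrite -!catA catA => /cancelV; rewrite -catA.
Qed.

End NormalClosure.

Section Evaluation.
Variables (G : groupType) (n : nat) (g : 'I_n -> G).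
Local Open Scope group_scope.

Lemma eval_word_cat u v : eval_word g (u ++ v) = eval_word g u * eval_word g v.
Proof. exact: big_cat. Qed.

Lemma eval_word_inv u : eval_word g (inv_word u) = (eval_word g u)^-1.
Proof.
elim: u => [|[i b] u IH]; first by rewrite /eval_word !big_nil invg1.
rewrite /inv_word /= rev_cons -cats1 eval_word_cat -/(inv_word u) IH.
rewrite -[in RHS]cat1s eval_word_cat invgM; congr mul.
by rewrite /eval_word !big_seq1; case: b => //=; rewrite invgK.
Qed.

Lemma eval_normal_closure (rels : seq (word n)) u :
  (forall r, r \in rels -> eval_word g r = 1) -> normal_closure rels u ->
  eval_word g u = 1.
Proof.
move=> relsE; have pair l : eval_word g [:: l; drev l] = 1.
  rewrite -cat1s eval_word_cat -[[:: drev l]]/(inv_word [:: l]) eval_word_inv.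
  exact: mulgV.
elim=> {u} [r /relsE//||u v _ IHu _ IHv|u _ IH|u v _ IH|u v l _|u v l _].
- exact: big_nil.
- by rewrite eval_word_cat IHu IHv mulg1.
- by rewrite eval_word_inv IH invg1.
- by rewrite !eval_word_cat IH mul1g eval_word_inv mulVg.
- by rewrite !eval_word_cat pair mul1g.
- by rewrite !eval_word_cat pair mul1g.
Qed.

Lemma group_closedP (H : set G) : group_closed [in H] <->
  H 1 /\ forall a b, H a -> H b -> H (a * b^-1).
Proof.
split=> -[H1 HD]; split=> [|a b]; rewrite ?inE //.
- by move: H1; rewrite inE.
- by have := HD a b; rewrite !inE.
- exact: HD.
Qed.

Lemma generated_sub (A : set G) : A `<=` generated A.
Proof. by move=> a Aa H _; apply. Qed.

Lemma generated_closed (A : set G) : group_closed [in generated A].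
Proof.
apply/group_closedP; split=> [H /group_closedP[H1 _] _ //|a b ha hb H Hc AH].
by have /group_closedP[_] := Hc; apply; [exact: ha|exact: hb].
Qed.

Lemma generatedP (A H : set G) : group_closed [in H] -> A `<=` H ->
  generated A `<=` H.
Proof. by move=> Hc AH a; apply. Qed.

Lemma eval_word_generated (A : set G) u :
  (forall i, A (g i)) -> generated A (eval_word g u).
Proof.
move=> gA; have /group_closedP[A1 AD] := generated_closed A.
have AV a : generated A a -> generated A a^-1 by rewrite -div1g; exact: AD.
have gA' i : generated A (g i) by exact: generated_sub.
elim: u => [|[i b] u IH]; first by rewrite /eval_word big_nil.
rewrite -cat1s eval_word_cat -[X in _ * X]invgK; apply: AD; last exact: AV.
by rewrite /eval_word big_seq1 /=; case: b => //; exact: AV.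
Qed.

End Evaluation.

Section Presentation.
Variables (Y : complex) (y : vert Y) (G : groupType) (f : pi1 y -> G).
Hypotheses (Ycp : compact Y) (Ycn : connected Y).
Hypothesis fM : {morph f : a b / (a * b)%g}.
Hypothesis fI : injective f.

Let f1 : f 1%g = 1%g.
Proof. by apply: (mulgI (f 1%g)); rewrite -fM !mulg1. Qed.

Let fV a : f a^-1%g = (f a)^-1%g.
Proof. by apply/esym/mulg1_eq; rewrite -fM mulgV. Qed.

Lemma range_morph_closed : group_closed [in range f].
Proof.
apply/group_closedP; split; first by exists 1%g.
by move=> _ _ [a _ <-] [b _ <-]; exists (a * b^-1)%g => //; rewrite fM fV.
Qed.

(** The generators are the 1-cells, each turned into a loop by the paths
    [tau] from the base point; the relators are the attaching paths and the
    paths [tau] themselves, which play the role of a maximal tree. Homotopies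
    of edge paths then become consequences of the relators, and since the
    [tau] are relators, a word is equivalent to the loop that it spells. *)
Lemma pi1_finitely_presented : finitely_presented (range f).
Proof.
have [/finite_seqP[vs vsE] /finite_seqP[es0 es0E] /finite_seqP[cs csE]] := Ycp.
have [tau tauP tau_base] := based_paths y Ycn.
pose es := undup es0; pose n := size es.
have es_all e : e \in es.
  by rewrite mem_undup; have : [set: edge Y] e by []; rewrite es0E.
have /choice[idx idxK] e : exists i : 'I_n, tnth (in_tuple es) i = e.
  have [i ->] := tnthP _ _ (es_all e : e \in in_tuple es); by exists i.
pose letter (d : dart Y) : 'I_n * bool := (idx d.1, d.2).
pose unletter (l : 'I_n * bool) : dart Y := (tnth (in_tuple es) l.1, l.2).
have letterK d : unletter (letter d) = d.
  by rewrite /unletter /= idxK -surjective_pairing.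
have unletterK l : letter (unletter l) = l.
  have tI : injective (tnth (in_tuple es)) by apply/tuple_uniqP/undup_uniq.
  by case: l => i b; congr pair; apply: tI; rewrite idxK.
pose W : seq (dart Y) -> word n := map letter.
have W_inv q : W (inv_path q) = inv_word (W q).
  by rewrite /W /inv_path /inv_word map_rev -!map_comp.
pose rels : seq (word n) := [seq W (tau v) | v <- vs] ++
  flatten [seq [seq W (bpath i) | i <- enum 'I_(len c)] | c <- cs].
have rel_tau v : normal_closure rels (W (tau v)).
  apply: nc_rel; rewrite mem_cat (map_f (fun v => W (tau v))) //.
  by have : [set: vert Y] v by []; rewrite vsE.
have rel_cell (c : cell Y) (i : 'I_(len c)) : normal_closure rels (W (bpath i)).
  apply: nc_rel; rewrite mem_cat; apply/orP; right; apply/flattenP.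
  exists [seq W (bpath i) | i <- enum 'I_(len c)].
    apply: (map_f (fun c => [seq W (bpath i) | i <- enum 'I_(len c)])).
    by have : [set: cell Y] c by []; rewrite csE.
  by apply: (map_f (fun i => W (bpath i))); rewrite mem_enum.
pose g i := f (dart_class tauP (unletter (i, false))).
have evalE u : eval_word g u = f (path_class tauP (map unletter u)).
  elim: u => [|[i b] u IH]; first by rewrite /eval_word /path_class !big_nil f1.
  rewrite /eval_word /path_class /= !big_cons fM -/(eval_word g u) IH; congr mul.
  by case: b => //=; rewrite /g -fV -dart_class_drev.
have evalW q : eval_word g (W q) = f (path_class tauP q).
  by rewrite evalE -map_comp (eq_map letterK) map_id.
have homW u v q r : homotopic u v q r -> forall a b,
    normal_closure rels (a ++ W q ++ b) <-> normal_closure rels (a ++ W r ++ b).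
  elim=> {q r} [//|q r _ IH a b|q r s _ IH1 _ IH2 a b|q r d _ a b|q r c i _ a b].
  - by rewrite IH.
  - by rewrite IH1.
  - rewrite /W !map_cat -!catA !(catA a).
    exact: (nc_cancel rels (a ++ W q) (W r ++ b) [:: letter d]).
  - rewrite /W !map_cat -!catA !(catA a); exact: nc_insert.
(* The detours only insert words of paths [tau], which are relators. *)
have detourW q a :
    normal_closure rels (a ++ W (flatten [seq detour tau d | d <- q])) <->
    normal_closure rels (a ++ W q).
  elim: q a => [//|d q IH] a.
  have -> : W (flatten [seq detour tau d | d <- d :: q]) = W (tau (dsrc d)) ++
      letter d :: inv_word (W (tau (dtgt d))) ++
      W (flatten [seq detour tau d | d <- q]).
    by rewrite /W /= /detour !map_cat /= -!/(W _) W_inv -catA.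
  rewrite (nc_insert _ _ (rel_tau _)) -cat1s catA.
  by rewrite (nc_insert _ _ (nc_inv (rel_tau _))) IH -catA.
exists n, g, rels; split.
  apply/seteqP; split=> [_ [a _ <-]|]; last first.
    apply: generatedP range_morph_closed _ => _ [i _ <-]; exact: imageT.
  elim/pi1_ind: a => l; rewrite -(path_class_loop tauP tau_base) -evalW.
  by apply: eval_word_generated => i; exists i.
move=> u; split; last first.
  apply: eval_normal_closure => r; rewrite mem_cat => /orP[/mapP[v _ ->]|].
    by rewrite evalW path_class_tau.
  by move=> /flattenP[_ /mapP[c _ ->] /mapP[i _ ->]]; rewrite evalW path_class_bpath.
rewrite evalE; have [l lE ->] := path_class_detours tauP (map unletter u).
rewrite -f1 => /fI/(pi1_classP l (loop1 y)); rewrite lE => h.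
have [_] := homW _ _ _ _ h [::] [::]; rewrite /= !cats0 => /(_ (nc_one _)).
move/(detourW _ [::]).1.
by rewrite /= /W -map_comp (eq_map unletterK) map_id.
Qed.

End Presentation.

(** * The covering space of a right action of the fundamental group *)

Section ActionCover.
Variables (X : complex) (x : vert X) (tau : vert X -> seq (dart X)).
Hypothesis tauP : forall v, epath x v (tau v).
Hypothesis tau_base : tau x = [::].
Variables (K : choiceType) (act : K -> pi1 x -> K).
Hypothesis act1 : forall k, act k 1%g = k.
Hypothesis actM : forall k a b, act (act k a) b = act k (a * b)%g.

Local Notation gam := (dart_class tauP).

Let cvert : choiceType := (vert X * K)%type.
Let cedge : choiceType := (edge X * K)%type.
Let ccell : choiceType := (cell X * K)%type.

Let csrc (e : cedge) : cvert := (esrc e.1, e.2).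
Let ctgt (e : cedge) : cvert := (etgt e.1, act e.2 (gam (e.1, false))).

(** A 1-cell of the cover is labelled by the sheet of its origin, so a dart
    that runs backwards carries the label of the sheet in which it ends. *)
Let lift (k : K) (d : dart X) : cedge * bool :=
  ((d.1, if d.2 then act k (gam d) else k), d.2).

Let actK k (d : dart X) : act (act k (gam d)) (gam (drev d)) = k.
Proof. by rewrite actM dart_class_drev mulgV act1. Qed.

Let lift_start k d : dstart csrc ctgt (lift k d) = (dsrc d, k).
Proof.
by case: d => e []; rewrite /dstart //= /ctgt /=; rewrite (actK k (e, true)).
Qed.

Let lift_drev k d : drev (lift k d) = lift (act k (gam d)) (drev d).
Proof. by case: d => e []; rewrite /lift /drev //= (actK k (e, false)). Qed.

(** Translation from the sheet in which the lifted attaching path of [c]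
    starts to the one in which it reaches its [i]-th 0-cell. The recursion
    [posS] also holds at the last 0-cell, because attaching paths are
    null-homotopic. *)
Let pos (c : cell X) (i : 'I_(len c)) : pi1 x :=
  path_class tauP [seq bd c (iter k (@ordS _) (Ordinal (len_gt0 c))) | k <- iota 0 i].

Let posS c (i : 'I_(len c)) : pos (ordS i) = (pos i * gam (bd c i))%g.
Proof.
set i0 := Ordinal (len_gt0 c).
have step : path_class tauP [seq bd c (iter k (@ordS _) i0) | k <- iota 0 i.+1] =
    (pos i * gam (bd c i))%g.
  rewrite -addn1 iotaD map_cat path_class_cat; congr mul.
  rewrite /path_class big_seq1; congr (gam (bd c _)); apply: val_inj.
  by rewrite /= iter_ordS /= !add0n modn_small.
have ordSE : ordS i = i.+1 %% len c :> nat by [].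
rewrite -step /pos ordSE; have := ltn_ord i; rewrite leq_eqVlt => /orP[/eqP e|lt].
  by rewrite e modnn [LHS]big_nil; exact: esym (path_class_bpath tauP i0).
by rewrite modn_small.
Qed.

Let cbd (c : ccell) (i : 'I_(len c.1)) : cedge * bool :=
  lift (act c.2 (pos i)) (bd c.1 i).

Fact cover_closed c (i : 'I_(len c.1)) :
  dstart csrc ctgt (drev (cbd i)) = dstart csrc ctgt (cbd (ordS i)).
Proof.
rewrite lift_drev !lift_start actM -posS; congr pair; exact: bd_closed.
Qed.

Fact cover_immersed c (i : 'I_(len c.1)) : cbd (ordS i) <> drev (cbd i).
Proof.
move=> h; apply: (@bd_immersed X c.1 i).
have := congr1 (fun d : cedge * bool => (d.1.1, d.2)) h.
by rewrite /= -surjective_pairing.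
Qed.

Definition action_cover : complex :=
  @Complex cvert cedge ccell csrc ctgt (fun c => len c.1) (fun c => len_gt0 c.1)
    cbd cover_closed cover_immersed.

Definition cover_map : cmap action_cover X :=
  @CMap action_cover X fst (fun e => (e.1, false)) fst (fun _ i => i) (fun=> false)
    (fun=> erefl) (fun=> erefl) (fun=> erefl) (fun _ _ => erefl)
    (fun c i => congr1 (pair _) (addbF _)).

Lemma cover_map_dart (d : dart action_cover) : fdart cover_map d = (d.1.1, d.2).
Proof. by rewrite /fdart /dflip /= addbF. Qed.

Let liftK (d : dart action_cover) : lift (dsrc d).2 (fdart cover_map d) = d.
Proof.
rewrite cover_map_dart; case: d => -[e k] []; rewrite /lift //=.
by rewrite (actK k (e, false)).
Qed.

Let map_lift k d : fdart cover_map (lift k d) = d.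
Proof. by rewrite cover_map_dart /= -surjective_pairing. Qed.

Lemma cover_covering : inhabited K -> covering cover_map.
Proof.
case=> k0; split.
- by move=> v; exists (v, k0).
- move=> [v k] d dv; exists (lift k d); split=> [|d' [d'v <-]].
    by rewrite map_lift; split=> //; rewrite [LHS]lift_start dv.
  by have := liftK d'; rewrite d'v.
- move=> [e k] [c i] /= ei.
  (* The lift of [c] that starts in the sheet [k'] has its side number [i] at
     the 1-cell labelled [act k' m]. *)
  pose m := (pos i * (if (bd c i).2 then gam (bd c i) else 1))%g.
  have cbdE k' : (cbd (c := (c, k')) i).1 = ((bd c i).1, act k' m).
    by rewrite /cbd /lift /m /=; case: (_.2); rewrite ?mulg1 ?actM.
  exists (Tagged (fun c : cell action_cover => 'I_(len c))
    (i : 'I_(len ((c, act k m^-1%g) : cell action_cover)))).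
  split=> [|[[c' k'] i'] [es ms]].
    split=> //; apply: etrans (cbdE _) _; rewrite actM mulVg act1; congr pair.
    exact: ei.
  have /= ecc' := congr1 (@tag _ _) ms; case: c / ecc' in i ei m cbdE ms *.
  have /= ii' := side_tagged_inj ms; rewrite -{}ii' in m cbdE ei ms *.
  have [_ <-] := etrans (esym (cbdE k')) es.
  by rewrite actM mulgV act1.
Qed.

Lemma cover_epath (u v : vert action_cover) q : epath u v q ->
  v.2 = act u.2 (path_class tauP [seq fdart cover_map d | d <- q]).
Proof.
elim: q u => [|d q IH] u; first by move=> /eqP <-; rewrite /path_class big_nil act1.
move=> /= /andP[/eqP <- /IH ->]; rewrite /path_class big_cons -actM; congr act.
have <- := congr1 (fun d => (dtgt (d : dart action_cover)).2) (liftK d).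
by rewrite /dtgt lift_drev [dsrc _]lift_start.
Qed.

Lemma cover_epath_lift (k : K) (l : loop x) : exists2 q,
  epath ((x, k) : vert action_cover) (x, act k (pi1_class l)) q &
  [seq fdart cover_map d | d <- q] = val l.
Proof.
have pC : covering cover_map by apply: cover_covering.
have [[v k'] [q [hq mq /= vx]]] := epath_lift pC (u := (x, k)) (valP l).
exists q => //; have /= ek := cover_epath hq.
by rewrite mq (path_class_loop tauP tau_base) in ek; rewrite vx ek in hq.
Qed.

(** Over the base point, lifts of loops reach all sheets since the action is
    transitive; the paths [tau] then lead to all 0-cells without changing
    sheet. *)
Lemma cover_connected : connected X -> (exists k0, forall k, exists a, act k0 a = k) ->
  connected action_cover.
Proof.
move=> Xc [k0 k0T]; split; first exact: (inhabits (x, k0)).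
have pC : covering cover_map by apply: cover_covering.
suff reach (v : vert action_cover) : exists q, epath ((x, k0) : vert action_cover) v q.
  move=> u v; have [q hq] := reach u; have [r hr] := reach v.
  by exists (inv_path q ++ r); apply: epath_catI (epath_inv hq) hr.
case: v => v k; have [a <-] := k0T k; elim/pi1_ind: a => l.
have [q hq mq] := cover_epath_lift k0 l.
have [[v' k'] [r [hr mr /= vv']]] :=
  epath_lift pC (u := (x, act k0 (pi1_class l))) (tauP v).
exists (q ++ r); apply: epath_catI hq _; have /= ek := cover_epath hr.
by rewrite mr (path_class_tau tauP tau_base) act1 in ek; rewrite vv' ek in hr.
Qed.

End ActionCover.

(** * Coherence *)

Section Cosets.
Variables (G : groupType) (H : set G).
Local Open Scope group_scope.
Hypothesis Hc : group_closed [in H].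

(** The product set [S a]; in this form it is a right action on all subsets,
    and the cosets of [H] are the orbit of [H]. *)
Definition translate (S : set G) (a : G) : set G := [set k | S (k * a^-1)].

Lemma translate1 S : translate S 1 = S.
Proof. by apply/seteqP; split=> k; rewrite /translate /= invg1 mulg1. Qed.

Lemma translateM S a b : translate (translate S a) b = translate S (a * b).
Proof. by apply/seteqP; split=> k; rewrite /translate /= invgM mulgA. Qed.

Definition cosets : choiceType := range (translate H).

Definition coset (a : G) : cosets :=
  exist _ (translate H a) (mem_set (imageT (translate H) a)).

Fact translate_coset (S : cosets) a : translate (val S) a \in range (translate H).
Proof.
have [b _ <-] := set_mem (valP S); rewrite translateM; apply/mem_set; exact: imageT.
Qed.

Definition coset_act (S : cosets) (a : G) : cosets :=
  exist _ (translate (val S) a) (translate_coset S a).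

Lemma coset_act1 S : coset_act S 1 = S.
Proof. by apply: val_inj; exact: translate1. Qed.

Lemma coset_actM S a b : coset_act (coset_act S a) b = coset_act S (a * b).
Proof. by apply: val_inj; exact: translateM. Qed.

Lemma coset_act_transitive S : exists a, coset_act (coset 1) a = S.
Proof.
have [a _ aS] := set_mem (valP S); exists a; apply: val_inj.
by rewrite /= translate1.
Qed.

Lemma coset_stab a : coset_act (coset 1) a = coset 1 <-> H a.
Proof.
have /group_closedP[H1 HD] := Hc; split=> [/(congr1 val)|Ha].
  rewrite /= translate1 => e; have : translate H a a by rewrite /translate /= mulgV.
  by rewrite e.
apply: val_inj; rewrite /= translate1; apply/seteqP; split=> k; rewrite /translate /=.
  move=> h; rewrite -[k](mulgVK a) -[X in _ * X]invgK; apply: (HD) => //.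
  by rewrite -div1g; exact: HD.
by move=> Hk; exact: HD.
Qed.

End Cosets.

Lemma add_darts_le_inv (X : complex) (C : subcomplex X) b D (Y : subcomplex X) :
  subcomplex_le (add_darts C b D) Y -> svert Y b /\ forall d, d \in D -> sedge Y d.1.
Proof.
move=> [hv he _]; split; first by apply: hv; right; left.
by move=> d dD; apply: he; right; exists d.
Qed.

Section Coherence.
Variables (X : complex) (w : weight X).
Hypotheses (Xc : connected X) (PR : perimeter_reduction w).

Definition empty_sub (Xh : complex) : subcomplex Xh :=
  @Subcomplex Xh set0 set0 set0 (fun _ => id) (fun _ => id) (fun _ _ => id).

Lemma compact_empty_sub (Xh : complex) : compact (complex_of (empty_sub Xh)).
Proof. by apply/compact_subP; split; exact: finite_set0. Qed.

(** A subcomplex of minimal perimeter injects on the fundamental group, as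
    its perimeter could be reduced otherwise. *)
Lemma minimal_pi1_injective (Xh : complex) (p : cmap Xh X) (C : subcomplex Xh) :
  covering p -> connected Xh -> compact (complex_of C) ->
  exists Y : subcomplex Xh,
    [/\ compact (complex_of Y), connected (complex_of Y), subcomplex_le C Y &
        pi1_injective (sub_incl Y)].
Proof.
move=> pC Xhc Ccp; have [Y [Ycp Ycn CY min]] := minimal_subcomplex w p Xhc Ccp.
exists Y; split=> //; apply: contrapT => /(perimeter_reduction_sub pC PR Ycp Ycn).
move=> [Y' [cp cn [v e c]]]; rewrite ltnNge min //.
by case: CY => v' e' c'; split; apply: subset_trans; eassumption.
Qed.

(** A finitely generated subgroup [H] is carried by a compact subcomplex of
    the covering space of the action on the cosets of [H]; a minimal
    subcomplex containing it has fundamental group [H]. *)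
Lemma pi1_coherent (x : vert X) : coherent (pi1 x).
Proof.
move=> H [A HA]; have Hc : group_closed [in H] by rewrite HA; exact: generated_closed.
have [tau tauP tau_base] := based_paths x Xc.
pose k0 := coset H 1%g.
have act1 := @coset_act1 _ H; have actM := @coset_actM _ H.
pose Xh := action_cover tauP act1 actM.
pose p : cmap Xh X := cover_map tauP act1 actM.
have pC : covering p by apply: cover_covering; exact: (inhabits k0).
have Xhc : connected Xh.
  by apply: cover_connected => //; exists k0; exact: coset_act_transitive.
pose b : vert Xh := (x, k0).
have loopP (a : pi1 x) : exists q, H a -> epath b b q /\
    [seq fdart p d | d <- q] = val (repr a).
  have [q hq mq] := cover_epath_lift tauP tau_base act1 actM k0 (repr a).
  exists q => Ha; split=> //; move: hq; rewrite pi1_reprK.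
  by rewrite (iffRL (coset_stab Hc a)).
have [q qP] := choice loopP.
pose D := flatten [seq q a | a <- A].
have [Y [Ycp Ycn CY Yinj]] := minimal_pi1_injective pC Xhc
  (compact_add_darts b D (compact_empty_sub Xh)).
have [bY DY] := add_darts_le_inv CY.
pose y : vert (complex_of Y) := exist _ b (mem_set bY).
have fy : cmap_comp p (sub_incl Y) y = x by [].
suff -> : H = range (pi1_map fy).
  apply: pi1_finitely_presented => //; first exact: pi1_mapM.
  apply/pi1_map_injP => l l' hl hl'; rewrite !map_fdart_comp => h.
  have [] := homotopic_lift pC (epath_map (sub_incl Y) hl) (epath_map (sub_incl Y) hl') h.
  by have /pi1_map_injP inj := Yinj y => _; exact: inj.
apply/seteqP; split.
  rewrite {1}HA; apply: generatedP.
    by apply: range_morph_closed; exact: pi1_mapM.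
  move=> a aA; have Ha : H a by rewrite HA; exact: generated_sub.
  have [hq mq] := qP a Ha; have [|bY' [r [hr mr]]] := epath_sub bY hq.
    move=> d dq; apply: DY; apply/flattenP; exists (q a) => //; exact: map_f.
  have hr' : epath y y r by move: hr; congr (is_true (epath _ _ _)); exact: val_inj.
  exists (pi1_class (exist (epath y y) _ hr')) => //.
  rewrite pi1_mapE -[RHS]pi1_reprK; congr pi1_class; apply: val_inj.
  by apply: etrans (map_fdart_comp _ _ _) _; rewrite mr mq.
(* A loop of [Y] returns to the sheet [k0], so its class stabilizes that
   sheet. *)
move=> _ [a _ <-]; elim/pi1_ind: a => l; rewrite pi1_mapE; apply/(coset_stab Hc).
rewrite -(path_class_loop tauP tau_base).
rewrite [val (loop_map _ _)](map_fdart_comp p (sub_incl Y)).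
exact: esym (cover_epath (epath_map (sub_incl Y) (valP l))).
Qed.

End Coherence.

Theorem theorem3p7 (X : complex) (w : weight X) :
  connected X -> perimeter_reduction w ->
  (forall (Xh : complex) (p : cmap Xh X), connected Xh -> covering p ->
     (forall Y : subcomplex Xh,
        compact (complex_of Y) -> connected (complex_of Y) ->
        ~ pi1_injective (sub_incl Y) ->
        exists Y' : subcomplex Xh,
          [/\ compact (complex_of Y'), connected (complex_of Y'),
              subcomplex_le Y Y' &
              perimeter w (cmap_comp p (sub_incl Y')) < perimeter w (cmap_comp p (sub_incl Y))])
     /\
     (forall C : subcomplex Xh, compact (complex_of C) ->
        exists Y : subcomplex Xh,
          [/\ compact (complex_of Y), connected (complex_of Y),
              subcomplex_le C Y &
              forall Y' : subcomplex Xh,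
                compact (complex_of Y') -> connected (complex_of Y') ->
                subcomplex_le C Y' ->
                perimeter w (cmap_comp p (sub_incl Y)) <= perimeter w (cmap_comp p (sub_incl Y'))]))
  /\
  (forall x : vert X, coherent (pi1 x)).
Proof.
move=> Xc PR; split=> [Xh p Xhc pC|x]; last exact: pi1_coherent PR x.
split; first exact: perimeter_reduction_sub.
by move=> C; exact: minimal_subcomplex.
Qed.
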